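(* If a category $\mathbf{C}$ admits a finite and convergent presentation, then $\mathbf{C}$ is of homological type $\mathrm{FP}_{\infty}$.
   Context: A $2$-polygraph $\Sigma$ consists of a set $\Sigma_0$, a graph $\Sigma_1$ over $\Sigma_0$ with free category $\Sigma_1^*$, and a set $\Sigma_2$ of $2$-cells $\varphi:u\Rightarrow v$ between parallel $1$-cells $u,v$ of $\Sigma_1^*$; $\Sigma^*$ is the free $2$-category it generates. It is finite when $\Sigma_0,\Sigma_1,\Sigma_2$ are finite. It is a presentation of $\mathbf{C}$ when the quotient category $\overline{\Sigma}=\Sigma_1^*/\Sigma_2$ (identifying the source and target of each element of $\Sigma_2$) is isomorphic to $\mathbf{C}$. A rewriting step is a $2$-cell $w\varphi w'$ of $\Sigma^*$ with $\varphi\in\Sigma_2$ and $w,w'$ $1$-cells of $\Sigma_1^*$. $\Sigma$ terminates when it has no infinite sequence of composable rewriting steps; it is confluent when for all $2$-cells $f:u\Rightarrow v$, $g:u\Rightarrow w$ of $\Sigma^*$ there are $2$-cells $v\Rightarrow u'$ and $w\Rightarrow u'$ of $\Sigma^*$ for some $u'$; it is convergent when it terminates and is confluent. The category of factorisations $F\mathbf{C}$ has the $1$-cells of $\mathbf{C}$ as objects, and as morphisms $w\to w'$ the pairs $(u,v)$ of $1$-cells with $uwv=w'$; composition is $(u,v)(u',v')=(u'u,vv')$. A natural system on $\mathbf{C}$ is a functor $F\mathbf{C}\to\mathbf{Ab}$; natural systems form an abelian category. A natural system is finitely generated when it is a quotient of a finite coproduct of functors $\mathbb{Z}F\mathbf{C}(w,-)$.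 $\mathbf{C}$ is of homological type $\mathrm{FP}_\infty$ when the constant natural system $\mathbb{Z}$ on $\mathbf{C}$ admits a resolution $\cdots\to P_n\to\cdots\to P_0\to\mathbb{Z}\to0$ by finitely generated projective natural systems. *)

(* Defs.v *)
From HB Require Import structures.
From mathcomp Require Import all_boot all_algebra.
From mathcomp Require Import boolp classical_sets cardinality.
From mathcomp Require Import freeg.

Set Implicit Arguments.
Unset Strict Implicit.
Unset Printing Implicit Defensive.

Import GRing.Theory.

Local Open Scope ring_scope.
Local Open Scope quotient_scope.

(* Composition is written in diagrammatic order: [f ;; g] is [f] followed by
   [g]. *)
Record category : Type := Category {
  obj :> Type;
  hom : obj -> obj -> Type;
  idc : forall x, hom x x;
  comp : forall x y z, hom x y -> hom y z -> hom x z;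
  comp_idl : forall x y (f : hom x y), comp (idc x) f = f;
  comp_idr : forall x y (f : hom x y), comp f (idc y) = f;
  comp_assoc : forall x y z t (f : hom x y) (g : hom y z) (h : hom z t),
    comp f (comp g h) = comp (comp f g) h }.

Arguments hom {c} x y.
Arguments idc {c} x.
Arguments comp {c x y z} f g.

Notation "f ;; g" := (comp f g) (at level 50, left associativity).

Record functor (C D : category) : Type := Functor {
  fobj :> C -> D;
  fmap : forall x y, hom x y -> hom (fobj x) (fobj y);
  fmap_id : forall x, fmap (idc x) = idc (fobj x);
  fmap_comp : forall x y z (f : hom x y) (g : hom y z),
    fmap (f ;; g) = fmap f ;; fmap g }.

Arguments fmap {C D} _ {x y} _.

Definition functor_id (C : category) : functor C C :=
  @Functor C C id (fun _ _ h => h) (fun _ => erefl) (fun _ _ _ _ _ => erefl).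

Section FunctorComp.
Variables (C D E : category) (F : functor C D) (G : functor D E).

Lemma functor_comp_id (x : C) : fmap G (fmap F (idc x)) = idc (G (F x)).
Proof. by rewrite !fmap_id. Qed.

Lemma functor_comp_comp (x y z : C) (f : hom x y) (g : hom y z) :
  fmap G (fmap F (f ;; g)) = fmap G (fmap F f) ;; fmap G (fmap F g).
Proof. by rewrite !fmap_comp. Qed.

Definition functor_comp : functor C E :=
  @Functor C E (fun x => G (F x)) (fun _ _ h => fmap G (fmap F h))
    functor_comp_id functor_comp_comp.

End FunctorComp.

Definition isomorphic (C D : category) : Prop :=
  exists (F : functor C D) (G : functor D C),
    functor_comp F G = functor_id C /\ functor_comp G F = functor_id D.

Record nat_trans (C D : category) (F G : functor C D) : Type := NatTrans {
  component :> forall x, hom (F x) (G x);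
  naturality : forall x y (f : hom x y),
    fmap F f ;; component y = component x ;; fmap G f }.

Inductive onecell (V : Type) (E : V -> V -> Type) : V -> V -> Type :=
| onil x : onecell E x x
| ocons x y z : E x y -> onecell E y z -> onecell E x z.

Arguments onil {V E} x.

Fixpoint ocat (V : Type) (E : V -> V -> Type) (x y z : V)
    (u : onecell E x y) : onecell E y z -> onecell E x z :=
  match u in onecell _ x y return onecell E y z -> onecell E x z with
  | onil _ => fun v => v
  | ocons _ _ _ e u' => fun v => ocons e (ocat u' v)
  end.

Section FreeCategory.
Variables (V : Type) (E : V -> V -> Type).

Lemma ocat_idr (x y : V) (u : onecell E x y) : ocat u (onil y) = u.
Proof. by elim: u => //= x' y' z e u ->. Qed.

Lemma ocat_assoc (x y z t : V) (u : onecell E x y) (v : onecell E y z)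
    (w : onecell E z t) : ocat u (ocat v w) = ocat (ocat u v) w.
Proof. by elim: u v => //= x' y' z' e u IH v; rewrite IH. Qed.

Definition free_category : category :=
  @Category V (onecell E) (fun x => onil x) (@ocat V E)
    (fun _ _ _ => erefl) ocat_idr ocat_assoc.

End FreeCategory.

Record polygraph : Type := Polygraph {
  cell0 : Type;
  cell1 : cell0 -> cell0 -> Type;
  cell2 : forall x y : cell0, onecell cell1 x y -> onecell cell1 x y -> Type }.

Definition star1 (S : polygraph) : category := free_category (@cell1 S).

Definition finite_type (T : Type) : Prop := finite_set [set: T].

Definition finite_polygraph (S : polygraph) : Prop :=
  [/\ finite_type (cell0 S),
      finite_type {x : cell0 S & {y : cell0 S & cell1 x y}} &
      finite_type {x : cell0 S & {y : cell0 S & {u : onecell (@cell1 S) x y &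
                   {v : onecell (@cell1 S) x y & cell2 u v}}}}].

(* Formal composites of the generating 2-cells.  The 2-cells of the free
   2-category are their classes modulo the axioms of 2-categories; source,
   target and existence of 2-cells, the only data used below, do not depend on
   passing to classes. *)
Inductive twocell (S : polygraph) :
    forall x y : star1 S, hom x y -> hom x y -> Type :=
| tgen (x y : star1 S) (u v : hom x y) : cell2 u v -> twocell u v
| tid (x y : star1 S) (u : hom x y) : twocell u u
| tvcomp (x y : star1 S) (u v w : hom x y) :
    twocell u v -> twocell v w -> twocell u w
| thcomp (x y z : star1 S) (u u' : hom x y) (v v' : hom y z) :
    twocell u u' -> twocell v v' -> twocell (u ;; v) (u' ;; v').

Definition whisker (S : polygraph) (x y z t : star1 S) (w : hom x y)
    (u v : hom y z) (phi : cell2 u v) (w' : hom z t) :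
    twocell (w ;; u ;; w') (w ;; v ;; w') :=
  thcomp (thcomp (tid w) (tgen phi)) (tid w').

Inductive rewriting_step (S : polygraph) (x t : star1 S) :
    forall u v : @hom (star1 S) x t, twocell u v -> Prop :=
| RewritingStep (y z : star1 S) (w : hom x y) (u v : hom y z)
    (phi : cell2 u v) (w' : hom z t) : rewriting_step (whisker w phi w').

Definition terminating (S : polygraph) : Prop :=
  ~ exists (x y : star1 S) (u : nat -> hom x y)
      (f : forall n, twocell (u n) (u n.+1)),
      forall n, rewriting_step (f n).

Definition confluent (S : polygraph) : Prop :=
  forall (x y : star1 S) (u v w : hom x y) (f : twocell u v) (g : twocell u w),
  exists (u' : hom x y) (f' : twocell v u') (g' : twocell w u'), True.

Definition convergent (S : polygraph) : Prop := terminating S /\ confluent S.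

(* Identities of the quotient category: the congruence on the free category
   generated by the 2-cells. *)
Inductive cong (S : polygraph) : forall x y : star1 S, hom x y -> hom x y -> Prop :=
| cong_gen (x y : star1 S) (u v : hom x y) : cell2 u v -> cong u v
| cong_refl (x y : star1 S) (u : hom x y) : cong u u
| cong_sym (x y : star1 S) (u v : hom x y) : cong u v -> cong v u
| cong_trans (x y : star1 S) (u v w : hom x y) :
    cong u v -> cong v w -> cong u w
| cong_comp (x y z : star1 S) (u u' : hom x y) (v v' : hom y z) :
    cong u u' -> cong v v' -> cong (u ;; v) (u' ;; v').

Section QuotientCategory.
Variable S : polygraph.
Implicit Types x y z t : star1 S.

Definition congb x y : rel {classic hom x y} := fun u v => `[< cong u v >].

Lemma congb_equiv x y : equiv_class_of (@congb x y).
Proof.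
split=> [u|u v|v u w]; rewrite /congb.
- by apply/asboolP; apply: cong_refl.
- by apply/asboolP/asboolP; apply: cong_sym.
- by move=> /asboolP uv /asboolP vw; apply/asboolP; apply: cong_trans uv vw.
Qed.

Canonical congb_equiv_rel x y := EquivRelPack (@congb_equiv x y).

Definition qhom x y : Type := {eq_quot (@congb x y)}.

Definition qproj x y (u : hom x y) : qhom x y :=
  \pi_({eq_quot (@congb x y)}) (u : {classic hom x y}).

Definition qrepr x y (a : qhom x y) : hom x y :=
  repr (a : {eq_quot (@congb x y)}).

Definition qcomp x y z (a : qhom x y) (b : qhom y z) : qhom x z :=
  qproj (qrepr a ;; qrepr b).

Lemma qprojP x y (u v : hom x y) : qproj u = qproj v <-> cong u v.
Proof.
split; first by move=> /eqmodP/asboolP.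
by move=> uv; apply/eqmodP/asboolP.
Qed.

Lemma qreprK x y (a : qhom x y) : qproj (qrepr a) = a.
Proof. exact: reprK. Qed.

Lemma qcomp_proj x y z (u : hom x y) (v : hom y z) :
  qcomp (qproj u) (qproj v) = qproj (u ;; v).
Proof. by apply/qprojP; apply: cong_comp; apply/qprojP; rewrite qreprK. Qed.

Lemma qcomp_idl x y (a : qhom x y) : qcomp (qproj (idc x)) a = a.
Proof. by rewrite -[a]qreprK qcomp_proj comp_idl. Qed.

Lemma qcomp_idr x y (a : qhom x y) : qcomp a (qproj (idc y)) = a.
Proof. by rewrite -[a]qreprK qcomp_proj comp_idr. Qed.

Lemma qcomp_assoc x y z t (a : qhom x y) (b : qhom y z) (c : qhom z t) :
  qcomp a (qcomp b c) = qcomp (qcomp a b) c.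
Proof. by rewrite -[a]qreprK -[b]qreprK -[c]qreprK !qcomp_proj comp_assoc. Qed.

Definition quotient_category : category :=
  @Category (star1 S) qhom (fun x => qproj (idc x)) qcomp
    qcomp_idl qcomp_idr qcomp_assoc.

End QuotientCategory.

Definition presentation (S : polygraph) (C : category) : Prop :=
  isomorphic (quotient_category S) C.

Record fact_obj (C : category) : Type := FactObj {
  fsrc : C;
  ftgt : C;
  farr : hom fsrc ftgt }.

(* The pair (u, v) = (fleft, fright) with u w v = w'. *)
Record fact_hom (C : category) (w w' : fact_obj C) : Type := FactHom {
  fleft : hom (fsrc w') (fsrc w);
  fright : hom (ftgt w) (ftgt w');
  factE : fleft ;; farr w ;; fright = farr w' }.

Section Factorisations.
Variable C : category.

Lemma fact_hom_eq (w w' : fact_obj C) (f g : fact_hom w w') :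
  fleft f = fleft g -> fright f = fright g -> f = g.
Proof.
case: f g => [u v e] [u' v' e'] /= uu' vv'; subst u' v'.
by rewrite (Prop_irrelevance e e').
Qed.

Lemma fact_id_subproof (w : fact_obj C) :
  idc (fsrc w) ;; farr w ;; idc (ftgt w) = farr w.
Proof. by rewrite comp_idl comp_idr. Qed.

Lemma fact_comp_subproof (w w' w'' : fact_obj C) (f : fact_hom w w')
    (g : fact_hom w' w'') :
  fleft g ;; fleft f ;; farr w ;; (fright f ;; fright g) = farr w''.
Proof. by rewrite -(factE g) -(factE f) !comp_assoc. Qed.

Definition fact_id (w : fact_obj C) : fact_hom w w :=
  FactHom (fact_id_subproof w).

Definition fact_comp (w w' w'' : fact_obj C) (f : fact_hom w w')
    (g : fact_hom w' w'') : fact_hom w w'' := FactHom (fact_comp_subproof f g).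

Lemma fact_comp_idl (w w' : fact_obj C) (f : fact_hom w w') :
  fact_comp (fact_id w) f = f.
Proof. by apply: fact_hom_eq; rewrite /= (comp_idl, comp_idr). Qed.

Lemma fact_comp_idr (w w' : fact_obj C) (f : fact_hom w w') :
  fact_comp f (fact_id w') = f.
Proof. by apply: fact_hom_eq; rewrite /= (comp_idl, comp_idr). Qed.

Lemma fact_comp_assoc (w1 w2 w3 w4 : fact_obj C) (f : fact_hom w1 w2)
    (g : fact_hom w2 w3) (h : fact_hom w3 w4) :
  fact_comp f (fact_comp g h) = fact_comp (fact_comp f g) h.
Proof. by apply: fact_hom_eq; rewrite /= comp_assoc. Qed.

Definition factorisations : category :=
  @Category (fact_obj C) (@fact_hom C) fact_id fact_comp
    fact_comp_idl fact_comp_idr fact_comp_assoc.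

End Factorisations.

Lemma additive_ext (A B : zmodType) (f g : {additive A -> B}) : f =1 g -> f = g.
Proof.
case: f g => [f [[fP]]] [g [[gP]]] /= fg.
have {}fg : f = g by apply: funext.
by subst g; rewrite (Prop_irrelevance fP gP).
Qed.

Section AbelianGroups.
Implicit Types A B D E : zmodType.

Definition additive_id A : {additive A -> A} := idfun.

Definition additive_comp A B D (f : {additive A -> B}) (g : {additive B -> D}) :
  {additive A -> D} := g \o f.

Lemma additive_comp_idl A B (f : {additive A -> B}) :
  additive_comp (additive_id A) f = f.
Proof. exact: additive_ext. Qed.

Lemma additive_comp_idr A B (f : {additive A -> B}) :
  additive_comp f (additive_id B) = f.
Proof. exact: additive_ext. Qed.

Lemma additive_comp_assoc A B D E (f : {additive A -> B})
    (g : {additive B -> D}) (h : {additive D -> E}) :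
  additive_comp f (additive_comp g h) = additive_comp (additive_comp f g) h.
Proof. exact: additive_ext. Qed.

Definition Ab : category :=
  @Category zmodType (fun A B => {additive A -> B}) additive_id additive_comp
    additive_comp_idl additive_comp_idr additive_comp_assoc.

End AbelianGroups.

Definition natsys (C : category) : Type := functor (factorisations C) Ab.

Definition nsval (C : category) (N : natsys C) (w : fact_obj C) : zmodType :=
  N w.

Definition nsact (C : category) (N : natsys C) (w w' : fact_obj C)
  (g : fact_hom w w') : {additive nsval N w -> nsval N w'} :=
  @fmap _ _ N (w : factorisations C) w' g.

Definition nsmap (C : category) (M N : natsys C) (f : nat_trans M N)
  (w : fact_obj C) : {additive nsval M w -> nsval N w} := f w.

Section NaturalSystems.
Variable C : category.

Definition constant_natsys (A : zmodType) : natsys C :=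
  @Functor (factorisations C) Ab (fun _ => A) (fun _ _ _ => idc (A : Ab))
    (fun _ => erefl) (fun _ _ _ _ _ => esym (comp_idl (idc (A : Ab)))).

(* The functor Z FC(w, -); [{classic T}] equips an arbitrary type with the
   choice structure that free abelian groups require. *)
Section FreeNatsys.
Variable w : fact_obj C.

Definition free_val (w' : fact_obj C) : zmodType :=
  {freeg {classic fact_hom w w'} / int}.

Definition free_fun (w1 w2 : fact_obj C) (g : fact_hom w1 w2) :
    free_val w1 -> free_val w2 :=
  fglift (fun f : {classic fact_hom w w1} =>
    << (fact_comp f g : {classic fact_hom w w2}) >>).

Lemma free_fun_additive (w1 w2 : fact_obj C) (g : fact_hom w1 w2) :
  zmod_morphism (free_fun g).
Proof. exact: lift_is_additive. Qed.

HB.instance Definition _ (w1 w2 : fact_obj C) (g : fact_hom w1 w2) :=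
  GRing.isZmodMorphism.Build (free_val w1) (free_val w2) (free_fun g)
    (free_fun_additive g).

Definition free_map (w1 w2 : fact_obj C) (g : fact_hom w1 w2) :
  @hom Ab (free_val w1) (free_val w2) := free_fun g.

Lemma free_funU (w1 w2 : fact_obj C) (g : fact_hom w1 w2) (f : fact_hom w w1) :
  free_fun g << (f : {classic fact_hom w w1}) >> =
  << (fact_comp f g : {classic fact_hom w w2}) >>.
Proof. by rewrite /free_fun liftU scale1r. Qed.

Lemma free_val_ext (w1 : fact_obj C) (A : zmodType)
    (a b : {additive free_val w1 -> A}) :
  (forall f : fact_hom w w1,
     a << (f : {classic fact_hom w w1}) >> =
     b << (f : {classic fact_hom w w1}) >>) -> a = b.
Proof.
move=> ab; apply: additive_ext => D; rewrite -[D]freeg_sumE !raddf_sum /=.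
apply: eq_bigr => f _; have -> : coeff f D = (coeff f D)%:~R by rewrite intz.
by rewrite -freegU_mulz !raddfMz ab.
Qed.

Lemma free_map_id (w1 : fact_obj C) :
  free_map (fact_id w1) = idc (free_val w1 : Ab).
Proof.
by apply: free_val_ext => f; rewrite /= free_funU fact_comp_idr.
Qed.

Lemma free_map_comp (w1 w2 w3 : fact_obj C) (g : fact_hom w1 w2)
    (h : fact_hom w2 w3) :
  free_map (fact_comp g h) = free_map g ;; free_map h.
Proof.
by apply: free_val_ext => f; rewrite /= !free_funU fact_comp_assoc.
Qed.

Definition free_natsys : natsys C :=
  @Functor (factorisations C) Ab free_val free_map free_map_id free_map_comp.

End FreeNatsys.
Definition zero_natsys : natsys C := constant_natsys 'rV[int]_0.

Section DirectSum.
Variables M N : natsys C.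

Definition dsum_val (w : fact_obj C) : zmodType := (nsval M w * nsval N w)%type.

Definition dsum_fun (w w' : fact_obj C) (g : fact_hom w w') :
    dsum_val w -> dsum_val w' :=
  fun a => (nsact M g a.1, nsact N g a.2).

Lemma dsum_fun_additive (w w' : fact_obj C) (g : fact_hom w w') :
  zmod_morphism (dsum_fun g).
Proof. by move=> a b; rewrite /dsum_fun !raddfB. Qed.

HB.instance Definition _ (w w' : fact_obj C) (g : fact_hom w w') :=
  GRing.isZmodMorphism.Build (dsum_val w) (dsum_val w') (dsum_fun g)
    (dsum_fun_additive g).

Definition dsum_map (w w' : fact_obj C) (g : fact_hom w w') :
  @hom Ab (dsum_val w) (dsum_val w') := dsum_fun g.

Lemma dsum_map_id (w : fact_obj C) : dsum_map (fact_id w) = idc (dsum_val w : Ab).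
Proof.
apply: additive_ext => -[a b]; rewrite /= /dsum_fun /nsact.
by rewrite !(fmap_id _ (w : factorisations C)).
Qed.

Lemma dsum_map_comp (w w' w'' : fact_obj C) (g : fact_hom w w')
    (h : fact_hom w' w'') :
  dsum_map (fact_comp g h) = dsum_map g ;; dsum_map h.
Proof.
apply: additive_ext => -[a b]; rewrite /= /dsum_fun /nsact.
by rewrite !(@fmap_comp _ _ _ (w : factorisations C) w' w'' g h).
Qed.

Definition dsum_natsys : natsys C :=
  @Functor (factorisations C) Ab dsum_val dsum_map dsum_map_id dsum_map_comp.

End DirectSum.

(* Finite coproducts of natural systems are pointwise direct sums. *)
Definition free_coproduct (ws : seq (fact_obj C)) : natsys C :=
  foldr (fun w N => dsum_natsys (free_natsys w) N) zero_natsys ws.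

(* Kernels, images and cokernels in the category of functors to abelian groups
   are computed pointwise, so epimorphisms and exactness are pointwise. *)
Definition ns_surjective (M N : natsys C) (f : nat_trans M N) : Prop :=
  forall (w : fact_obj C) (b : nsval N w), exists a, nsmap f w a = b.

Definition ns_exact (L M N : natsys C) (f : nat_trans L M) (g : nat_trans M N) :
    Prop :=
  forall (w : fact_obj C) (b : nsval M w),
    nsmap g w b = 0 <-> exists a, nsmap f w a = b.

Definition ns_fin_generated (N : natsys C) : Prop :=
  exists (ws : seq (fact_obj C)) (q : nat_trans (free_coproduct ws) N),
    ns_surjective q.

Definition ns_projective (P : natsys C) : Prop :=
  forall (M N : natsys C) (q : nat_trans M N) (f : nat_trans P N),
    ns_surjective q ->
    exists g : nat_trans P M, forall w a, nsmap q w (nsmap g w a) = nsmap f w a.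

End NaturalSystems.

Definition FP_infty (C : category) : Prop :=
  exists (P : nat -> natsys C) (d : forall n, nat_trans (P n.+1) (P n))
      (eps : nat_trans (P 0) (constant_natsys C int)),
    [/\ forall n, ns_fin_generated (P n) /\ ns_projective (P n),
        ns_surjective eps,
        ns_exact (d 0) eps &
        forall n, ns_exact (d n.+1) (d n)].

(* Main.v *)
(** A convergent presentation gives every morphism of [C] a unique irreducible
    word.  Following Brown and Anick, an n-chain is a sequence [t_1, ..., t_n] of
    irreducible words, [t_1] a letter, where [t_(i+1)] is minimal such that
    [t_i t_(i+1)] is reducible; since the left-hand sides of rules have bounded
    length, there are finitely many n-chains.  The resolution is free on the
    chains.  A generator [u.c.v] over an n-chain [c] either extends, by cutting off
    the shortest prefix [t] of [v] making [c t] an (n+1)-chain, or is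
    "collapsible".  The boundary of [c t] is [1.c.t - z], where [z] is a lower
    element with the same boundary as [1.c.t]: the order compares the underlying
    words by rewriting, then declares a longer [u] to be lower.  Triangularity gives
    both halves of exactness: noetherian induction makes every element congruent,
    modulo boundaries, to a combination of collapsible generators, and no nonzero
    combination of collapsible generators is a cycle.  As the reduction never goes
    up, exactness in degree n again provides a lower [z] in degree n+1. *)

From HB Require Import structures.
From mathcomp Require Import all_boot all_algebra.
From mathcomp Require Import boolp classical_sets cardinality.
From mathcomp Require Import freeg.
From Stdlib Require Import Relation_Operators Transitive_Closure Eqdep.
Require Import Defs.

Set Implicit Arguments.
Unset Strict Implicit.
Unset Printing Implicit Defensive.

Import GRing.Theory.

Local Open Scope classical_set_scope.

(** * Normal forms from convergent presentations *)

Lemma finite_typeP (T : Type) :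
  finite_type T -> exists l : seq {classic T}, forall x, x \in l.
Proof.
move=> /(@finite_seqP {classic T})[l lE]; exists l => x.
by have : [set` l] x by rewrite -lE.
Qed.

(* Objects are indexed by the small type [vertex] because the universe of [obj C]
   lies above that of [zmodType], hence above the types accepted by
   [{classic _}]. *)
Record normal_forms (C : category) : Type := NormalForms {
  vertex : choiceType;
  vertex_obj : vertex -> C;
  alphabet : choiceType;
  represents : forall x y : C, hom x y -> seq alphabet -> Prop;
  nf : forall x y : C, hom x y -> seq alphabet;
  irreducible : seq alphabet -> Prop;
  rewrites : forall x y : C, hom x y -> seq alphabet -> seq alphabet -> Prop;
  finite_vertices : exists l : seq vertex, forall v, v \in l;
  vertex_obj_inj : injective vertex_obj;
  vertex_obj_surj : forall x, exists v, vertex_obj v = x;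
  finite_alphabet : exists l : seq alphabet, forall a, a \in l;
  represents_nf : forall x y (f : hom x y), represents f (nf f);
  represents_idc : forall x, represents (idc x) [::];
  represents_comp : forall x y z (f : hom x y) (g : hom y z) s t,
    represents f s -> represents g t -> represents (f ;; g) (s ++ t);
  represents_split : forall x z (h : hom x z) s t, represents h (s ++ t) ->
    exists y (f : hom x y) (g : hom y z),
      [/\ represents f s, represents g t & h = f ;; g];
  represents_inj : forall x y z (f : hom x y) (g : hom x z) s,
    represents f s -> represents g s -> existT (hom x) y f = existT (hom x) z g;
  irreducible_nf : forall x y (f : hom x y), irreducible (nf f);
  irreducibleE : forall x y (f : hom x y) s,
    represents f s -> irreducible s -> s = nf f;
  irreducible_factor : forall s t u,
    irreducible (s ++ t ++ u) -> irreducible t;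
  rewrites_nf : forall x y (f : hom x y) s,
    represents f s -> ~ irreducible s -> rewrites f s (nf f);
  rewrites_trans : forall x y (f : hom x y) s t u,
    rewrites f s t -> rewrites f t u -> rewrites f s u;
  rewrites_comp : forall x y z t (f : hom x y) (g : hom y z) (h : hom z t) p s s' q,
    represents f p -> rewrites g s s' -> represents h q ->
    rewrites (f ;; g ;; h) (p ++ s ++ q) (p ++ s' ++ q);
  rewrites_wf : forall x y (f : hom x y),
    well_founded (fun s t => rewrites f t s);
  minimal_bound : exists N, forall s t, irreducible t -> ~ irreducible (s ++ t) ->
    (forall p a q, t = p ++ a :: q -> irreducible (s ++ p)) -> size t <= N
}.

(** * Words as plain sequences of letters *)

Section Letters.
Variables (V : Type) (E : V -> V -> Type).

(** Edges are packed with their endpoints, so that words become sequences that can be cut and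
    compared without dependent types. *)
Definition letter : Type := {x : V & {y : V & E x y}}.

Fixpoint letters (x y : V) (u : onecell E x y) : seq {classic letter} :=
  match u with
  | onil _ => [::]
  | ocons x y _ e v =>
    (existT _ x (existT _ y e) : {classic letter}) :: letters v
  end.

Lemma letters_cat (x y z : V) (u : onecell E x y) (v : onecell E y z) :
  letters (ocat u v) = letters u ++ letters v.
Proof. by elim: u v => //= x' y' z' e u IH v; rewrite IH. Qed.

Lemma letters_split (x y : V) (u : onecell E x y) s t : letters u = s ++ t ->
  exists z (v : onecell E x z) (w : onecell E z y),
    [/\ letters v = s, letters w = t & u = ocat v w].
Proof.
elim: u s => [x'|x' y' z' e u IH] [|a s] //=.
- by move=> <-; exists x', (onil x'), (onil x').
- by move=> <-; exists x', (onil x'), (ocons e u).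
- by case=> <- /IH[z [v [w [<- <- ->]]]]; exists z, (ocons e v), w.
Qed.

(** Each letter carries its target, so the sequence determines the end of the word once the source
    is fixed; fixing the source also settles the empty word, which has no letters. *)
Lemma letters_inj_src (x y z : V) (u : onecell E x y) (v : onecell E x z) :
  letters u = letters v -> existT (onecell E x) y u = existT (onecell E x) z v.
Proof.
elim: u z v => [x'|x' y' y'' e u IH] z v; first by case: v.
case: v e => // x2 y2 z2 e2 v e /= uv.
have ee : existT _ x2 (existT _ y' e) = existT _ x2 (existT _ y2 e2) :> letter.
  exact: (f_equal (head (existT _ x2 (existT _ y' e) : {classic letter})) uv).
move: (inj_pairT2 _ _ _ _ _ ee) => {}ee.
have {}uv : letters u = letters v := f_equal behead uv.
have yy := f_equal (@projT1 _ _) ee; rewrite /= in yy; subst y2.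
rewrite (inj_pairT2 _ _ _ _ _ ee).
by have /= := f_equal (fun p : {t : V & onecell E y' t} =>
   existT (onecell E x2) (projT1 p) (ocons e2 (projT2 p))) (IH _ _ uv).
Qed.

Lemma letters_inj (x y : V) : injective (@letters x y).
Proof. by move=> u v /letters_inj_src uv; apply: inj_pairT2 uv. Qed.

End Letters.

(** * Reduction, confluence and reduced words *)

Section Rewriting.
Variable S : polygraph.
Hypothesis S_terminating : terminating S.
Hypothesis S_confluent : confluent S.

Local Notation word := (onecell (@cell1 S)).
Local Notation letter := {classic letter (@cell1 S)}.

Definition step (x y : cell0 S) (u v : word x y) : Prop :=
  exists f : @twocell S x y u v, rewriting_step f.

Lemma stepP (x t : cell0 S) (u v : word x t) :
  step u v <-> exists y z (w : word x y) (l r : word y z) (w' : word z t),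
    [/\ inhabited (@cell2 S y z l r), u = ocat (ocat w l) w' &
        v = ocat (ocat w r) w'].
Proof.
split=> [[f []]|[y [z [w [l [r [w' [[phi] -> ->]]]]]]]].
  by move=> y z w l r phi w'; exists y, z, w, l, r, w'.
by exists (whisker w phi w'); constructor.
Qed.

Lemma step_ctx (x y z t : cell0 S) (p : word x y) (u v : word y z)
    (q : word z t) : step u v -> step (ocat (ocat p u) q) (ocat (ocat p v) q).
Proof.
move=> /stepP[y' [z' [w [l [r [w' [phi -> ->]]]]]]]; apply/stepP.
exists y', z', (ocat p w), l, r, (ocat w' q); split=> //.
  by rewrite !ocat_assoc.
by rewrite !ocat_assoc.
Qed.

(** [terminating] forbids infinite sequences. A word that is not accessible has a successor that is
    not accessible either, so choice and iteration would build such a sequence. *)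
Lemma step_wf (x y : cell0 S) : well_founded (fun v u : word x y => step u v).
Proof.
move=> u0; apply: contrapT => nacc.
pose bad := {u : word x y | ~ Acc (fun v u : word x y => step u v) u}.
have next (b : bad) : {c : bad | step (sval b) (sval c)}.
  apply: cid; apply: contrapT => nex; apply: (svalP b); constructor => v uv.
  by apply: contrapT => nv; apply: nex; exists (exist _ v nv).
pose b n := iter n (fun b => sval (next b)) (exist _ u0 nacc : bad).
apply: S_terminating; exists x, y, (fun n => sval (b n)).
have bstep n : {f : @twocell S x y (sval (b n)) (sval (b n.+1)) | rewriting_step f}.
  exact/cid/(svalP (next (b n))).
by exists (fun n => sval (bstep n)) => n; apply: svalP.
Qed.

Definition steps (x y : cell0 S) : word x y -> word x y -> Prop :=
  clos_trans _ (@step x y).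

Lemma steps_ctx (x y z t : cell0 S) (p : word x y) (u v : word y z)
    (q : word z t) : steps u v -> steps (ocat (ocat p u) q) (ocat (ocat p v) q).
Proof.
elim=> [u' v' /step_ctx uv|u' v' w' _ uv _ vw]; first exact: t_step.
exact: t_trans uv vw.
Qed.

Lemma steps_wf (x y : cell0 S) : well_founded (fun v u : word x y => steps u v).
Proof.
move=> u; have : Acc (clos_trans _ (fun v u : word x y => step u v)) u.
  exact/wf_clos_trans/step_wf.
elim=> {}u _ IH; constructor=> v uv; apply: IH.
elim: uv => [u' v' uv|u' v' w' _ uv _ vw]; first exact: t_step.
exact: t_trans vw uv.
Qed.

Definition reduces (x y : cell0 S) (u v : word x y) : Prop := u = v \/ steps u v.

Lemma reduces_trans (x y : cell0 S) (u v w : word x y) :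
  reduces u v -> reduces v w -> reduces u w.
Proof.
move=> [->//|uv] [<-|vw]; first by right.
by right; apply: t_trans uv vw.
Qed.

Lemma reduces_ctx (x y z t : cell0 S) (p : word x y) (u v : word y z)
    (q : word z t) : reduces u v ->
  reduces (ocat (ocat p u) q) (ocat (ocat p v) q).
Proof. by case=> [->|uv]; [left | right; apply: steps_ctx]. Qed.

Lemma twocell_reduces (x y : star1 S) (u v : hom x y) :
  twocell u v -> reduces u v.
Proof.
elim=> {x y u v} [x y u v phi|x y u|x y u v w _ uv _ vw|x y z u u' v v' _ uu' _ vv'].
- right; apply: t_step; apply/stepP; exists x, y, (onil x), u, v, (onil y).
  by rewrite /= !ocat_idr; split.
- by left.
- exact: reduces_trans uv vw.
- have := reduces_ctx (onil x) v uu'; have := reduces_ctx u' (onil z) vv'.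
  by rewrite /= !ocat_idr => vv uu; apply: reduces_trans uu vv.
Qed.

Lemma step_cong (x y : star1 S) (u v : hom x y) : step u v -> cong u v.
Proof.
move=> /stepP[y' [z' [w [l [r [w' [[phi] -> ->]]]]]]].
apply: (cong_comp (u := ocat w l) (u' := ocat w r)); last exact: cong_refl.
by apply: (cong_comp (u := w) (u' := w)); [apply: cong_refl | apply: cong_gen].
Qed.

Lemma reduces_cong (x y : star1 S) (u v : hom x y) : reduces u v -> cong u v.
Proof.
case=> [->|]; first exact: cong_refl.
elim=> [u' v' /step_cong//|u' v' w' _ uv _ vw]; exact: cong_trans uv vw.
Qed.

(** Induction on the congruence. Confluence enters in the transitivity case, where it joins the two
    2-cells out of the middle word. *)
Lemma church_rosser (x y : star1 S) (u v : hom x y) : cong u v ->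
  exists w : hom x y, inhabited (twocell u w) /\ inhabited (twocell v w).
Proof.
elim=> {x y u v} [x y u v phi|x y u|x y u v _ [w [uw vw]]|
    x y u v w _ [s [[us] [vs]]] _ [t [[vt] [wt]]]|
    x y z u u' v v' _ [s [[us] [us']]] _ [t [[vt] [vt']]]].
- by exists v; split; constructor; [apply: tgen | apply: tid].
- by exists u; split; constructor; apply: tid.
- by exists w.
- have [r [f [g _]]] := S_confluent vs vt.
  by exists r; split; constructor; [apply: tvcomp us f | apply: tvcomp wt g].
- by exists (s ;; t); split; constructor; apply: thcomp.
Qed.

Definition lhs (s : seq letter) : Prop :=
  exists (x y : cell0 S) (u v : word x y), inhabited (@cell2 S x y u v) /\ letters u = s.

Definition reduced (s : seq letter) : Prop :=
  forall p l q, s = p ++ l ++ q -> ~ lhs l.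

(** A rule with empty source has the form [1 => v] with [v] a loop; it would rewrite [w] to [w v]
    forever. *)
Lemma lhs_nonempty : ~ lhs [::].
Proof.
move=> [x [y [u [v [[phi]]]]]]; move: v phi.
case: u => // x' v phi _.
have grow (w : word x' x') : step w (ocat w v).
  by apply/stepP; exists x', x', w, (onil x'), v, (onil x'); rewrite !ocat_idr.
by elim: (step_wf (onil x')) => w _ IH; apply: IH (grow w).
Qed.

Lemma letters_src (x y x' y' : cell0 S) (u : word x y) (v : word x' y') :
  letters u <> [::] -> letters u = letters v -> x = x'.
Proof.
case: u => // {}x z {}y e u _; case: v => // {}x' z' {}y' e' v /= uv.
exact: (f_equal (fun s => projT1 (head (existT _ x (existT _ z e) : letter) s)) uv).
Qed.

Lemma reducedP (x y : cell0 S) (u : word x y) :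
  reduced (letters u) <-> ~ exists v, step u v.
Proof.
split=> [ru [v /stepP[y' [z' [w [l [r [w' [phi uE _]]]]]]]]|irr p l q uE].
  apply: (ru (letters w) (letters l) (letters w')); last by exists y', z', l, r.
  by rewrite uE !letters_cat catA.
(* A nonempty left-hand side determines its source by its first letter, and then its target by
   [letters_inj_src]. Its occurrence in the sequence is therefore an occurrence of the rule in the
   word. *)
move=> lhs_l; have l0 : l <> [::] by move=> l0; apply: lhs_nonempty; rewrite -l0.
case: lhs_l => y1 [z1 [l1 [r [phi l1E]]]].
have [y2 [w [u' [wE u'E uE']]]] := letters_split uE.
have [z2 [l2 [w' [l2E w'E u'E']]]] := letters_split u'E.
have ly := letters_src (u := l1) (v := l2).
rewrite l1E l2E in ly; move: (ly l0 erefl) => {}ly; subst y1.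
have {}l1E : letters l1 = letters l2 by rewrite l1E l2E.
have lE := letters_inj_src l1E; have lz := f_equal (@projT1 _ _) lE.
rewrite /= in lz; subst z1; have {lE} lE := inj_pairT2 _ _ _ _ _ lE; subst l1.
apply: irr; exists (ocat (ocat w r) w'); apply/stepP.
by exists y2, z2, w, l2, r, w'; rewrite uE' u'E' ocat_assoc.
Qed.

Lemma reduced_factor s t u : reduced (s ++ t ++ u) -> reduced t.
Proof.
move=> stu p l q tE; apply: (stu (s ++ p) l (q ++ u)).
by rewrite tE !catA.
Qed.

Lemma normalise (x y : cell0 S) (u : word x y) :
  exists v, reduces u v /\ reduced (letters v).
Proof.
elim: (step_wf u) => {}u _ IH.
have [[v uv]|irr] := pselect (exists v, step u v).
  have [w [vw rw]] := IH v uv; exists w; split=> //.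
  by apply: reduces_trans vw; right; apply: t_step.
by exists u; split; [left | apply/reducedP].
Qed.

Lemma reduced_steps (x y : cell0 S) (u v : word x y) :
  reduced (letters u) -> ~ steps u v.
Proof.
move=> /reducedP ru uv; apply: ru.
by elim: uv => [u' v' uv|u' v' w' _ IH _ _]; [exists v' | ].
Qed.

Lemma reduced_cong (x y : star1 S) (u v : hom x y) :
  reduced (letters u) -> reduced (letters v) -> cong u v -> u = v.
Proof.
move=> ru rv /church_rosser[w [[/twocell_reduces uw] [/twocell_reduces vw]]].
have -> : u = w by case: uw => // /reduced_steps.
by case: vw => // /reduced_steps.
Qed.

(** * Transport along the isomorphism between the quotient category and [C] *)

Section Presented.
Variables (C : category) (F : functor (quotient_category S) C).
Variable G : functor C (quotient_category S).
Hypothesis FG : functor_comp F G = functor_id (quotient_category S).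
Hypothesis GF : functor_comp G F = functor_id C.

Lemma fobjK (x : quotient_category S) : G (F x) = x.
Proof. exact: (f_equal (fun H : functor _ _ => H x) FG). Qed.

Lemma gobjK (x : C) : F (G x) = x.
Proof. exact: (f_equal (fun H : functor _ _ => H x) GF). Qed.

(** Stated for a variable [H] so that the equation of functors can be substituted, although the
    types of the morphisms depend on [H]. *)
Lemma fmap_endo_bij (D : category) (H : functor D D) (x y : D) :
  H = functor_id D -> bijective (@fmap _ _ H x y).
Proof. by move=> ->; exists id. Qed.

Lemma fmapG_inj (x y : C) : injective (@fmap _ _ G x y).
Proof.
move=> f g fg; apply: (bij_inj (fmap_endo_bij x y GF)).
by rewrite /= fg.
Qed.

Lemma fmapF_inj (x y : quotient_category S) : injective (@fmap _ _ F x y).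
Proof.
move=> f g fg; apply: (bij_inj (fmap_endo_bij x y FG)).
by rewrite /= fg.
Qed.

Lemma fmapG_surj (x y : C) (a : @hom (quotient_category S) (G x) (G y)) :
  exists f : hom x y, fmap G f = a.
Proof.
have [g _ gK] := fmap_endo_bij x y GF.
exists (g (fmap F a)); apply: fmapF_inj; exact: gK.
Qed.

Definition spells (x y : C) (f : hom x y) (s : seq letter) : Prop :=
  exists u : word (G x) (G y), letters u = s /\ qproj u = fmap G f.

Definition respells (x y : C) (f : hom x y) (s t : seq letter) : Prop :=
  exists u v : word (G x) (G y),
    [/\ letters u = s, letters v = t, qproj u = fmap G f & steps u v].

Lemma spells_normal_exists (x y : C) (f : hom x y) :
  exists s, spells f s /\ reduced s.
Proof.
have [v [uv rv]] := normalise (qrepr (fmap G f)).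
exists (letters v); split=> //; exists v; split=> //.
by rewrite -[RHS]qreprK; apply/qprojP/cong_sym/reduces_cong.
Qed.

Definition normal (x y : C) (f : hom x y) : seq letter :=
  sval (cid (spells_normal_exists f)).

Lemma spells_normal (x y : C) (f : hom x y) : spells f (normal f).
Proof. exact: (svalP (cid (spells_normal_exists f))).1. Qed.

Lemma normal_reduced (x y : C) (f : hom x y) : reduced (normal f).
Proof. exact: (svalP (cid (spells_normal_exists f))).2. Qed.

Lemma spells_idc (x : C) : spells (idc x) [::].
Proof. by exists (onil (G x)); split=> //; rewrite fmap_id. Qed.

Lemma spells_comp (x y z : C) (f : hom x y) (g : hom y z) s t :
  spells f s -> spells g t -> spells (f ;; g) (s ++ t).
Proof.
move=> [u [<- uf]] [v [<- vg]]; exists (ocat u v); split.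
  exact: letters_cat.
by rewrite fmap_comp -uf -vg; symmetry; apply: qcomp_proj.
Qed.

Lemma spells_split (x z : C) (h : hom x z) s t : spells h (s ++ t) ->
  exists y (f : hom x y) (g : hom y z), [/\ spells f s, spells g t & h = f ;; g].
Proof.
move=> [w [wE wh]]; have [y [u [v [us vt uv]]]] := letters_split wE.
(* The intermediate vertex is replaced by [G (F y)], so that both halves become words between images
   of objects of [C]. *)
move: u v us vt uv; rewrite -(fobjK y) => u v us vt uv.
have [f fu] := fmapG_surj (qproj u : @hom (quotient_category S) _ _).
have [g gv] := fmapG_surj (qproj v : @hom (quotient_category S) _ _).
exists (F y), f, g; split; [by exists u | by exists v |].
by apply: fmapG_inj; rewrite fmap_comp fu gv -wh uv; symmetry; apply: qcomp_proj.
Qed.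

Lemma spells_inj (x y z : C) (f : hom x y) (g : hom x z) s :
  spells f s -> spells g s -> existT (hom x) y f = existT (hom x) z g.
Proof.
move=> [u [us uf]] [v [vs vg]].
have uv := letters_inj_src (etrans us (esym vs)).
have yz : y = z.
  by rewrite -(gobjK y) -(gobjK z); congr (F _); apply: (f_equal (@projT1 _ _) uv).
subst z; have {uv} uv := inj_pairT2 _ _ _ _ _ uv; subst v.
by congr existT; apply: fmapG_inj; rewrite -uf -vg.
Qed.

Lemma reduced_normal (x y : C) (f : hom x y) s :
  spells f s -> reduced s -> s = normal f.
Proof.
move=> [u [<- uf]]; have [v [vE vf]] := spells_normal f; have := @normal_reduced _ _ f.
rewrite -vE => rv ru; congr letters; apply: reduced_cong ru rv _.
by apply/qprojP; rewrite uf vf.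
Qed.

Lemma respells_normal (x y : C) (f : hom x y) s :
  spells f s -> ~ reduced s -> respells f s (normal f).
Proof.
move=> [u [<- uf]] nru; have [v [uv rv]] := normalise u.
exists u, v; split=> //; last by case: uv => // uv; case: nru; rewrite uv.
apply: reduced_normal => //; exists v; split=> //.
by rewrite -uf; apply/qprojP/cong_sym/reduces_cong.
Qed.

Lemma respells_trans (x y : C) (f : hom x y) s t u :
  respells f s t -> respells f t u -> respells f s u.
Proof.
move=> [a [b [<- bt af ab]]] [b' [c [bt' <- _ bc]]].
have bb : b = b' by apply: letters_inj; rewrite bt.
by subst b'; exists a, c; split=> //; apply: t_trans ab bc.
Qed.

Lemma respells_comp (x y z t : C) (f : hom x y) (g : hom y z) (h : hom z t)
    p s s' q : spells f p -> respells g s s' -> spells h q ->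
  respells (f ;; g ;; h) (p ++ s ++ q) (p ++ s' ++ q).
Proof.
move=> [a [<- af]] [u [v [<- <- ug uv]]] [b [<- bh]].
exists (ocat (ocat a u) b), (ocat (ocat a v) b); split.
- by rewrite !letters_cat catA.
- by rewrite !letters_cat catA.
- by rewrite !fmap_comp -af -ug -bh; symmetry; rewrite /= !qcomp_proj.
- exact: steps_ctx.
Qed.

Lemma respells_wf (x y : C) (f : hom x y) :
  well_founded (fun s t => respells f t s).
Proof.
(* The sequence [s] may come from no word from [G x] to [G y]. One respelling reaches a sequence
   that does, and from there [steps_wf] applies. *)
move=> s; constructor=> t [_ [u [_ <- _ _]]].
elim: (steps_wf u) => {}u _ IH; constructor=> _ [u' [v [uE <- _ uv]]].
by apply: IH; rewrite -(letters_inj uE).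
Qed.

Hypothesis S_finite : finite_polygraph S.

Lemma lhs_bounded : exists N, forall s, lhs s -> size s <= N.
Proof.
case: S_finite => _ _ /finite_typeP[rules rulesP].
pose len (r : {x : cell0 S & {y : cell0 S & {u : word x y & {v : word x y &
  cell2 u v}}}}) := size (letters (projT1 (projT2 (projT2 r)))).
exists (\max_(r <- rules) len r) => s [x [y [u [v [[phi] <-]]]]].
pose r := existT (fun x => {y : cell0 S & {u : word x y & {v : word x y &
  cell2 u v}}}) x (existT _ y (existT _ u (existT _ v phi))).
exact: (@leq_bigmax_seq _ rules predT len r (rulesP r) isT).
Qed.

(** A left-hand side occurring in [s ++ t] must reach the last letter, because [s] followed by a
    proper prefix of [t] is reduced. It is at least as long as [t], because a shorter one would lie
    inside the reduced word [t]. *)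
Lemma reduced_minimal_bound : exists N, forall s t,
  reduced t -> ~ reduced (s ++ t) ->
  (forall p a q, t = p ++ a :: q -> reduced (s ++ p)) -> size t <= N.
Proof.
have [N lhsN] := lhs_bounded; exists N => s t rt nst min.
have [p [l [q [stE lhs_l]]]] : exists p l q, s ++ t = p ++ l ++ q /\ lhs l.
  apply: contrapT => nex; apply: nst => p l q stE lhs_l; apply: nex.
  by exists p, l, q.
case/lastP: t => // t a in rt nst min stE *.
case/lastP: q stE => [|q b] stE.
  rewrite cats0 in stE; case: (leqP (size (rcons t a)) (size l)) => [|lt].
    by move=> /leq_trans; apply; apply: lhsN.
  have sp : size s <= size p.
    have := congr1 size stE; rewrite !size_cat => sz.
    by rewrite -(leq_add2r (size l)) -sz leq_add2l ltnW.
  case: (rt (drop (size s) p) l [::]) => //; rewrite cats0.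
  have := congr1 (drop (size s)) stE; rewrite drop_size_cat // drop_cat => ->.
  have [//|ps] := ltnP; have -> : size s = size p by apply/eqP; rewrite eqn_leq sp.
  by rewrite subnn drop0 drop_size.
have /rcons_inj[stE' _] : rcons (s ++ t) a = rcons (p ++ l ++ q) b.
  by rewrite !rcons_cat.
by case: (min t a [::] _ p l q stE' lhs_l); rewrite cats1.
Qed.

Lemma normal_forms_of_presentation : normal_forms C.
Proof.
have [finV finE _] := S_finite.
have {}finE : exists l : seq letter, forall a, a \in l by apply: finite_typeP.
have inj : injective (fun v : {classic cell0 S} => F v).
  move=> v w vw.
  by rewrite -(fobjK v) -(fobjK w); apply: (f_equal (fobj G) vw).
have surj (x : C) : exists v : {classic cell0 S}, F v = x.
  by exists (G x); apply: gobjK.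
exact: (NormalForms (finite_typeP finV) inj surj finE spells_normal spells_idc
  spells_comp spells_split spells_inj normal_reduced reduced_normal
  reduced_factor respells_normal respells_trans respells_comp respells_wf
  reduced_minimal_bound).
Defined.

End Presented.
End Rewriting.

(** * Free natural systems *)

Section FreeAbelianGroup.
Local Open Scope ring_scope.
Variable K : choiceType.
Implicit Types (A : K -> Prop) (D : {freeg K / int}).

(** Closure under differences yields sums and opposites, hence all integer multiples of the basis
    elements in the support. *)
Lemma freeg_span_ind A (P : {freeg K / int} -> Prop) :
  P 0 -> (forall D1 D2, P D1 -> P D2 -> P (D1 - D2)) ->
  (forall k, A k -> P << k >>) ->
  forall D, (forall k, coeff k D != 0 -> A k) -> P D.
Proof.
move=> P0 PB PU D AD.
have PD D1 D2 : P D1 -> P D2 -> P (D1 + D2).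
  by move=> P1 P2; rewrite -[D2]opprK -[- D2]sub0r; apply/PB/PB.
rewrite -[D]freeg_sumE big_seq; elim/big_ind: _ => // k.
rewrite mem_dom => /AD/PU Pk.
have -> : coeff k D = (coeff k D)%:~R by rewrite intz.
rewrite -freegU_mulz; have PMn n : P (<< k >> *+ n).
  by elim: n => // n IH; rewrite mulrS; apply: PD.
case: (coeff k D) => n; first exact: PMn.
by rewrite NegzE mulrNz -sub0r; apply: PB => //; apply: PMn.
Qed.

Definition in_span A D : Prop := forall k, coeff k D != 0 -> A k.

Lemma in_span0 A : in_span A 0.
Proof. by move=> k; rewrite coeff0 eqxx. Qed.

Lemma in_spanB A D1 D2 : in_span A D1 -> in_span A D2 -> in_span A (D1 - D2).
Proof.
move=> A1 A2 k; rewrite coeffB; have [-> |/A1//] := eqVneq (coeff k D1) 0.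
by rewrite sub0r oppr_eq0 => /A2.
Qed.

Lemma in_spanD A D1 D2 : in_span A D1 -> in_span A D2 -> in_span A (D1 + D2).
Proof.
move=> A1 A2; rewrite -[D2]opprK -[- D2]sub0r.
by apply: in_spanB A1 (in_spanB (in_span0 A) A2).
Qed.

Lemma in_spanU A k : A k -> in_span A << k >>.
Proof. by move=> Ak k'; rewrite coeffU mul1r; case: (k =P k') => [<-|]. Qed.

Lemma in_span_sub A B D :
  (forall k, A k -> B k) -> in_span A D -> in_span B D.
Proof. by move=> AB AD k /AD/AB. Qed.

Section Lift.
Variables (M : zmodType) (f : K -> M).

(** [zmodule M] is the group [M] with its canonical structure of module over the integers, which
    [fglift] requires. *)
Definition freeg_lift : {freeg K / int} -> M := fglift (f : K -> zmodule M).

Lemma freeg_lift_additive : zmod_morphism freeg_lift.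
Proof. exact: (@lift_is_additive int K (zmodule M) f). Qed.

HB.instance Definition _ := GRing.isZmodMorphism.Build {freeg K / int} M
  freeg_lift freeg_lift_additive.

Lemma freeg_liftU k : freeg_lift << k >> = f k.
Proof. by rewrite /freeg_lift liftU scale1r. Qed.

End Lift.

Lemma freeg_additive_ext (M : zmodType) (f g : {additive {freeg K / int} -> M}) :
  (forall k, f << k >> = g << k >>) -> f =1 g.
Proof.
move=> fg D.
refine (@freeg_span_ind (fun=> True) (fun D => f D = g D) _ _ _ D _) => //.
  by rewrite !raddf0.
by move=> D1 D2 E1 E2; rewrite !raddfB E1 E2.
Qed.

End FreeAbelianGroup.

Section NaturalSystems.
Variable C : category.

Lemma nsact_id (N : natsys C) (w : fact_obj C) a : nsact N (fact_id w) a = a.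
Proof. by rewrite /nsact (fmap_id _ (w : factorisations C)). Qed.

Lemma nsact_comp (N : natsys C) (w w' w'' : fact_obj C) (g : fact_hom w w')
    (h : fact_hom w' w'') a :
  nsact N (fact_comp g h) a = nsact N h (nsact N g a).
Proof. by rewrite /nsact (@fmap_comp _ _ _ (w : factorisations C) w' w'' g h). Qed.

Lemma nsmap_nat (M N : natsys C) (f : nat_trans M N) (w w' : fact_obj C)
    (g : fact_hom w w') a :
  nsmap f w' (nsact M g a) = nsact N g (nsmap f w a).
Proof.
exact: (f_equal (fun h : {additive _ -> _} => h a)
  (@naturality _ _ _ _ f (w : factorisations C) w' g)).
Qed.

Section MakeTransformation.
Variables (M N : natsys C).
Variable f : forall w, {additive nsval M w -> nsval N w}.
Hypothesis f_nat : forall w w' (g : fact_hom w w') a,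
  f w' (nsact M g a) = nsact N g (f w a).

Definition make_nat_trans : nat_trans M N.
Proof.
refine (@NatTrans (factorisations C) Ab M N f _) => w w' g.
by apply: additive_ext => a; apply: f_nat.
Defined.

End MakeTransformation.

Lemma comp_nat_trans_nat (L M N : natsys C) (f : nat_trans L M)
    (g : nat_trans M N) w w' (h : fact_hom w w') a :
  (nsmap g w' \o nsmap f w') (nsact L h a) = nsact N h ((nsmap g w \o nsmap f w) a).
Proof.
exact: etrans (congr1 (nsmap g w') (nsmap_nat f h a)) (nsmap_nat g h _).
Qed.

Definition comp_nat_trans (L M N : natsys C) (f : nat_trans L M)
    (g : nat_trans M N) : nat_trans L N :=
  make_nat_trans (f := fun w => nsmap g w \o nsmap f w) (comp_nat_trans_nat f g).

Lemma comp_nat_transE (L M N : natsys C) (f : nat_trans L M)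
    (g : nat_trans M N) w a :
  nsmap (comp_nat_trans f g) w a = nsmap g w (nsmap f w a).
Proof. by []. Qed.

Section FreeNaturalSystem.
Variables (I : choiceType) (o : I -> fact_obj C).

(** The basis at [w] of the coproduct of the representables [Z FC(o i, -)]: an index [i] together
    with a factorisation of [w] through [o i]. *)
Definition generator (w : fact_obj C) : Type := {i : I & fact_hom (o i) w}.

Definition generator_act (w w' : fact_obj C) (g : fact_hom w w')
    (b : generator w) : generator w' :=
  existT _ (projT1 b) (fact_comp (projT2 b) g).

Definition fns_val (w : fact_obj C) : zmodType :=
  {freeg {classic generator w} / int}.

Definition fns_gen (w : fact_obj C) (b : generator w) : fns_val w :=
  << (b : {classic generator w}) >>%R.

Definition fns_map (w w' : fact_obj C) (g : fact_hom w w') :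
    @hom Ab (fns_val w) (fns_val w') :=
  freeg_lift (fun b : {classic generator w} => fns_gen (generator_act g b)).

Lemma fns_map_id (w : fact_obj C) : fns_map (fact_id w) = idc (fns_val w : Ab).
Proof.
apply: additive_ext; apply: freeg_additive_ext => -[i f].
by rewrite /= freeg_liftU /generator_act /= fact_comp_idr.
Qed.

Lemma fns_map_comp (w w' w'' : fact_obj C) (g : fact_hom w w')
    (h : fact_hom w' w'') :
  fns_map (fact_comp g h) = fns_map g ;; fns_map h.
Proof.
apply: additive_ext; apply: freeg_additive_ext => -[i f].
by rewrite /= !freeg_liftU /generator_act /= fact_comp_assoc.
Qed.

Definition free_ns : natsys C :=
  @Functor (factorisations C) Ab fns_val fns_map fns_map_id fns_map_comp.

Lemma free_ns_actU (w w' : fact_obj C) (g : fact_hom w w') (b : generator w) :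
  nsact free_ns g (fns_gen b) = fns_gen (generator_act g b).
Proof. exact: freeg_liftU. Qed.

Section Spans.
Variable w : fact_obj C.
Implicit Types (P : generator w -> Prop) (a : nsval free_ns w).

Definition spanned P a : Prop := @in_span {classic generator w} P a.

Lemma spanned_ind P (Q : nsval free_ns w -> Prop) :
  Q 0%R -> (forall a b, Q a -> Q b -> Q (a - b)%R) ->
  (forall b, P b -> Q (fns_gen b)) -> forall a, spanned P a -> Q a.
Proof.
move=> Q0 QB QU a; exact: (@freeg_span_ind {classic generator w} P Q Q0 QB QU a).
Qed.

Lemma free_ns_ind (Q : nsval free_ns w -> Prop) :
  Q 0%R -> (forall a b, Q a -> Q b -> Q (a - b)%R) ->
  (forall b, Q (fns_gen b)) -> forall a, Q a.
Proof. by move=> Q0 QB QU a; apply: (@spanned_ind (fun=> True) Q). Qed.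

Lemma spanned0 P : spanned P 0%R.
Proof. exact: (@in_span0 {classic generator w}). Qed.

Lemma spannedB P a b : spanned P a -> spanned P b -> spanned P (a - b)%R.
Proof. exact: (@in_spanB {classic generator w} P). Qed.

Lemma spannedD P a b : spanned P a -> spanned P b -> spanned P (a + b)%R.
Proof. exact: (@in_spanD {classic generator w} P). Qed.

Lemma spanned_gen P b : P b -> spanned P (fns_gen b).
Proof. exact: (@in_spanU {classic generator w}). Qed.

Lemma spanned_sub P Q a : (forall b, P b -> Q b) -> spanned P a -> spanned Q a.
Proof. exact: (@in_span_sub {classic generator w} P Q). Qed.

End Spans.

Lemma spanned_act w w' (g : fact_hom w w') (P : generator w -> Prop)
    (Q : generator w' -> Prop) a :
  (forall b, P b -> Q (generator_act g b)) -> spanned P a ->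
  spanned Q (nsact free_ns g a).
Proof.
move=> PQ; move: a; apply: spanned_ind.
- by rewrite raddf0; apply: spanned0.
- by move=> a b Qa Qb; rewrite raddfB; apply: spannedB.
- by move=> b /PQ Qb; rewrite free_ns_actU; apply: spanned_gen.
Qed.

Section FreeLift.
Variables (N : natsys C) (x : forall i, nsval N (o i)).

Definition free_ns_lift_fun (w : fact_obj C) : {additive nsval free_ns w -> nsval N w} :=
  freeg_lift (fun b : {classic generator w} => nsact N (projT2 b) (x (projT1 b))).

Lemma free_ns_lift_nat w w' (g : fact_hom w w') a :
  free_ns_lift_fun w' (nsact free_ns g a) = nsact N g (free_ns_lift_fun w a).
Proof.
move: a; apply: (freeg_additive_ext
  (f := free_ns_lift_fun w' \o nsact free_ns g) (g := nsact N g \o free_ns_lift_fun w)).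
move=> b; rewrite /= -/(fns_gen b) (free_ns_actU g b) /fns_gen.
by rewrite /free_ns_lift_fun /= !freeg_liftU nsact_comp.
Qed.

Definition free_ns_lift : nat_trans free_ns N := make_nat_trans free_ns_lift_nat.

Lemma free_ns_liftU w (b : generator w) :
  nsmap free_ns_lift w (fns_gen b) = nsact N (projT2 b) (x (projT1 b)).
Proof. exact: freeg_liftU. Qed.

End FreeLift.

Lemma free_ns_ext (N : natsys C) (f g : nat_trans free_ns N) :
  (forall i, nsmap f (o i) (fns_gen (existT _ i (fact_id (o i)))) =
             nsmap g (o i) (fns_gen (existT _ i (fact_id (o i))))) ->
  forall w a, nsmap f w a = nsmap g w a.
Proof.
move=> fg w; apply: freeg_additive_ext => -[i h].
have -> : << (existT _ i h : {classic generator w}) >>%R =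
    nsact free_ns h (fns_gen (existT _ i (fact_id (o i)))).
  by rewrite free_ns_actU /generator_act /= fact_comp_idl.
by rewrite !nsmap_nat fg.
Qed.

(** By Yoneda, a transformation out of [free_ns] is determined by arbitrary values at the identity
    generators; preimages of the values of [f] are chosen there. *)
Lemma free_ns_projective : ns_projective free_ns.
Proof.
move=> M N q f q_surj.
pose x i := cid (q_surj (o i)
  (nsmap f (o i) (fns_gen (existT _ i (fact_id (o i)))))).
exists (free_ns_lift (fun i => sval (x i))) => w a.
rewrite -comp_nat_transE; apply: free_ns_ext => i.
by rewrite comp_nat_transE free_ns_liftU nsact_id (svalP (x i)).
Qed.

(** The map out of a direct sum given by the inclusion of the [i]-th representable and by [q];
    iterated over a list, it gives a map out of [free_coproduct]. *)
Definition coproduct_gen (i : I) (N : natsys C) (q : nat_trans N free_ns)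
    (w : fact_obj C) : nsval (dsum_natsys (free_natsys (o i)) N) w ->
    nsval free_ns w :=
  fun a => (freeg_lift (fun g : {classic fact_hom (o i) w} =>
    fns_gen (existT _ i (g : fact_hom (o i) w))) a.1 + nsmap q w a.2)%R.

Lemma coproduct_gen_additive i N q w : zmod_morphism (@coproduct_gen i N q w).
Proof.
move=> a b; rewrite /coproduct_gen.
have [-> ->] : (a - b).1%R = (a.1 - b.1)%R /\ (a - b).2%R = (a.2 - b.2)%R by [].
by rewrite !raddfB opprD addrACA.
Qed.

HB.instance Definition _ i N q w := GRing.isZmodMorphism.Build _ _
  (@coproduct_gen i N q w) (@coproduct_gen_additive i N q w).

Lemma coproduct_gen_nat i N q w w' (g : fact_hom w w') a :
  @coproduct_gen i N q w' (nsact _ g a) =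
  nsact free_ns g (@coproduct_gen i N q w a).
Proof.
case: a => a b; rewrite /coproduct_gen raddfD /= nsmap_nat; congr (_ + _)%R.
move: a; apply: (freeg_additive_ext (f := freeg_lift _ \o nsact (free_natsys (o i)) g)
   (g := nsact free_ns g \o freeg_lift _)) => h /=.
by rewrite (@free_funU _ (o i)) !freeg_liftU.
Qed.

Lemma free_ns_fin_generated (l : seq I) : (forall i, i \in l) ->
  ns_fin_generated free_ns.
Proof.
move=> l_all.
(* For an induction on the list, the claim only asks to reach the generators whose index occurs in
   it. *)
have [q qE] : exists q : nat_trans (free_coproduct (map o l)) free_ns,
    forall i, i \in l -> forall w (g : fact_hom (o i) w),
    exists a, nsmap q w a = fns_gen (existT _ i g).
  elim: {l_all}l => [|i l [q qE]].
    pose z w : {additive nsval (zero_natsys C) w -> nsval free_ns w} := \0%R.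
    by exists (@make_nat_trans (zero_natsys C) free_ns z
      ltac:(by move=> w w' g a; symmetry; apply: raddf0)).
  exists (@make_nat_trans (dsum_natsys (free_natsys (o i)) _) free_ns
    (fun w => @coproduct_gen i _ q w) (@coproduct_gen_nat i _ q)) => j.
  rewrite inE => /orP[/eqP->|/qE qj] w g.
    exists (<< (g : {classic fact_hom (o i) w}) >>, 0)%R.
    rewrite -[LHS]/(freeg_lift _ << (g : {classic fact_hom (o i) w}) >> +
      nsmap q w 0)%R.
    by rewrite raddf0 addr0 freeg_liftU.
  have [a <-] := qj w g; exists (0, a)%R.
  rewrite -[LHS]/(freeg_lift _ 0 + nsmap q w a)%R.
  by rewrite raddf0 add0r.
exists (map o l), q => w b.
refine (@freeg_span_ind _ (fun=> True) (fun D => exists a, nsmap q w a = D) _ _ _ b _) => //.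
- by exists 0%R; rewrite raddf0.
- by move=> _ _ [a1 <-] [a2 <-]; exists (a1 - a2)%R; rewrite raddfB.
- by move=> [i g] _; apply: qE.
Qed.

End FreeNaturalSystem.
End NaturalSystems.

(** * Chains and their boundaries *)

Lemma injective_enum (T : choiceType) (K : eqType) (f : T -> K) (l : seq K) :
  injective f -> (forall x, f x \in l) -> exists l' : seq T, forall x, x \in l'.
Proof.
move=> f_inj fl.
pose g k := if pselect (exists x, f x = k) is left H then Some (sval (cid H)) else None.
exists (pmap g l) => x; rewrite mem_pmap; apply/mapP; exists (f x) => //.
rewrite /g; case: pselect => [H|[]]; last by exists x.
by congr Some; apply: f_inj; rewrite (svalP (cid H)).
Qed.

Lemma exists_maximal (T : eqType) (R : T -> T -> Prop) (l : seq T) : l <> [::] ->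
  (forall x y z, R x y -> R y z -> R x z) -> (forall x, ~ R x x) ->
  exists2 m, m \in l & forall x, x \in l -> ~ R m x.
Proof.
move=> l0 R_trans R_irr; elim: l l0 => // x [_ _|y l IH _].
  by exists x; rewrite ?inE // => y; rewrite inE => /eqP->.
have [//|m ml m_max] := IH; have [mx|mx] := pselect (R m x); last first.
  by exists m => [|z]; rewrite inE ?ml ?orbT // => /orP[/eqP->|/m_max].
exists x => [|z]; rewrite inE ?eqxx // => /orP[/eqP->//|/m_max mz xz].
by apply: mz; apply: R_trans mx xz.
Qed.

Fixpoint words_upto (A : eqType) (l : seq A) (n : nat) : seq (seq A) :=
  if n is m.+1 then [::] :: [seq a :: s | a <- l, s <- words_upto l m] else [:: [::]].

Lemma mem_words_upto (A : eqType) (l : seq A) n s :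
  (forall a, a \in l) -> size s <= n -> s \in words_upto l n.
Proof.
move=> l_all; elim: n s => [|n IH] [|a s] //= sn.
by rewrite inE; apply/orP; right; apply: allpairs_f => //; apply: IH.
Qed.

Section Resolution.
Variables (C : category) (NF : normal_forms C).
Local Notation A := (alphabet NF).
Local Notation word := (seq A).
Local Notation irr := (@irreducible C NF).
Local Notation nf := (@nf C NF _ _).
Local Notation represents := (@represents C NF _ _).
Local Notation rewrites := (@rewrites C NF _ _).
Local Notation vobj := (@vertex_obj C NF).

Lemma irreducible_prefix (s t : word) : irr (s ++ t) -> irr s.
Proof. exact: (@irreducible_factor _ _ [::]). Qed.

Lemma irreducible_suffix (s t : word) : irr (s ++ t) -> irr t.
Proof. by move=> st; apply: (@irreducible_factor _ NF s t [::]); rewrite cats0. Qed.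

Lemma nf_idc (x : C) : nf (idc x) = [::].
Proof.
symmetry; apply: irreducibleE (represents_idc _ _) _.
exact: (@irreducible_prefix [::] (nf (idc x)) (irreducible_nf NF (idc x))).
Qed.

Lemma nf_inj_src (x y z : C) (f : hom x y) (g : hom x z) :
  nf f = nf g -> existT (hom x) y f = existT (hom x) z g.
Proof.
move=> fg; apply: represents_inj (represents_nf NF f) _.
by rewrite fg; apply: represents_nf.
Qed.

Lemma nf_inj (x y : C) (f g : hom x y) : nf f = nf g -> f = g.
Proof. by move=> /nf_inj_src fg; apply: inj_pairT2 fg. Qed.

Lemma nf_eq_nil (x y : C) (f : hom x y) : nf f = [::] ->
  existT (hom x) y f = existT (hom x) x (idc x).
Proof. by move=> f0; apply: nf_inj_src; rewrite f0 nf_idc. Qed.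

Lemma nf_comp_irreducible (x y z : C) (f : hom x y) (g : hom y z) :
  irr (nf f ++ nf g) -> nf (f ;; g) = nf f ++ nf g.
Proof.
by move=> fg; symmetry; apply: irreducibleE fg; apply: represents_comp;
   apply: represents_nf.
Qed.

Lemma nf_comp (x y z : C) (f : hom x y) (g : hom y z) :
  nf (f ;; g) = nf f ++ nf g \/ rewrites (f ;; g) (nf f ++ nf g) (nf (f ;; g)).
Proof.
have [fg|fg] := pselect (irr (nf f ++ nf g)).
  by left; apply: nf_comp_irreducible.
by right; apply: rewrites_nf fg; apply: represents_comp; apply: represents_nf.
Qed.

Lemma nf_split (x z : C) (h : hom x z) (s t : word) : nf h = s ++ t ->
  exists y (f : hom x y) (g : hom y z), [/\ nf f = s, nf g = t & f ;; g = h].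
Proof.
move=> hst; have := represents_nf NF h; rewrite hst.
move=> /represents_split[y [f [g [fs gt ->]]]].
have st := irreducible_nf NF h; rewrite hst in st.
exists y, f, g; split=> //; symmetry; apply: irreducibleE => //.
  exact: irreducible_prefix st.
exact: irreducible_suffix st.
Qed.

Definition position : Type := (word * nat)%type.

(* [lower f q p] for positions [(word, length of the left factor)]: the bound
   [q.2 <= size q.1] makes the relation well founded. *)
Definition lower (x y : C) (f : hom x y) (q p : position) : Prop :=
  rewrites f p.1 q.1 \/ q.1 = p.1 /\ p.2 < q.2 <= size q.1.

Lemma lower_trans (x y : C) (f : hom x y) p q r :
  lower f r q -> lower f q p -> lower f r p.
Proof.
case: p q r => [p i] [q j] [r k]; rewrite /lower /=.
move=> [qr|[-> /andP[jk kq]]] [pq|[qp /andP[ij jq]]].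
- by left; apply: rewrites_trans pq qr.
- by left; rewrite -qp.
- by left.
- by right; split=> //; rewrite (ltn_trans ij jk).
Qed.

Lemma lower_wf (x y : C) (f : hom x y) : well_founded (lower f).
Proof.
move=> [s k]; elim: (rewrites_wf (n := NF) f s) k => {}s _ IHs k.
(* On a fixed word, the measure is the number of letters to the right of the left factor. *)
have [m] := ubnP (size s - k); elim: m k => [k|m IHm k sk]; first by rewrite ltn0.
constructor=> -[t j] [/= st|[/= -> /andP[kj js]]]; first exact: IHs.
by apply: IHm; apply: leq_trans (ltn_sub2l _ kj) _; rewrite ?(leq_trans kj js).
Qed.

Lemma lower_irreflexive (x y : C) (f : hom x y) p : ~ lower f p p.
Proof. by elim: (lower_wf f p) => {}p _ IH pp; apply: (IH p). Qed.

(* [extendable c v] says that some prefix of [v] extends [c] to a longer chain: [v]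
   is nonempty if [c] is a vertex, otherwise the last word of [c] followed by [v]
   is reducible. *)
Record chains : Type := Chains {
  chain :> choiceType;
  chain_obj : chain -> fact_obj C;
  chain_word : chain -> word;
  extendable : chain -> word -> Prop;
  represents_chain : forall c, represents (farr (chain_obj c)) (chain_word c);
  extendable_nil : forall c, ~ extendable c [::];
  extendable_cat : forall c s t, extendable c s -> extendable c (s ++ t);
  chain_enum : exists l : seq chain, forall c, c \in l;
  extension_bound : exists N, forall c t, irr t -> extendable c t ->
    (forall p a q, t = p ++ a :: q -> ~ extendable c p) -> size t <= N
}.

Definition minimal_extension (D : chains) (c : D) (t : word) : Prop :=
  extendable c t /\ forall p a q, t = p ++ a :: q -> ~ extendable c p.

Lemma minimal_extension_exists (D : chains) (c : D) s : extendable c s ->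
  exists t u, s = t ++ u /\ minimal_extension c t.
Proof.
elim/last_ind: s => [/extendable_nil//|s a IH] csa.
have [/IH[t [u [-> ct]]]|cs] := pselect (extendable c s).
  by exists t, (rcons u a); rewrite rcons_cat.
exists (rcons s a), [::]; rewrite cats0; split=> //; split=> // p b q.
case/lastP: q => [|q b'].
  by rewrite cats1 => /rcons_inj[<- _].
rewrite -rcons_cons -rcons_cat => /rcons_inj[sE _] cp; apply: cs.
by rewrite sE; apply: extendable_cat.
Qed.

(** Two prefixes of one word are comparable, and minimality of the longer one forbids the shorter
    one to be a proper prefix of it. *)
Lemma minimal_extension_uniq (D : chains) (c : D) s t u v :
  minimal_extension c s -> minimal_extension c t -> s ++ u = t ++ v -> s = t.
Proof.
wlog st : s t u v / size s <= size t => [hw cs ct stuv|].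
  by have [st|/ltnW ts] := leqP (size s) (size t);
    [apply: hw stuv | symmetry; apply: hw (esym stuv)].
move=> [cs _] [_ ct] stuv.
have sE : s = take (size s) t.
  by have := congr1 (take (size s)) stuv; rewrite take_size_cat // takel_cat.
case E : (drop (size s) t) => [|a q].
  by rewrite -(cat_take_drop (size s) t) E cats0.
by case: (ct s a q) => //; rewrite -E {1}sE cat_take_drop.
Qed.

(** The 0-chains. As any nonempty word extends them, a minimal extension is a single letter, whence
    the bound 1. *)
Definition vertex_chains : chains.
Proof.
refine (@Chains (vertex NF) (fun v => FactObj (idc (vobj v))) (fun=> [::])
  (fun _ s => s <> [::]) (fun v => represents_idc NF _) (fun _ => @^~ erefl) _
  (finite_vertices NF) _); first by move=> v [].
exists 1 => v [|a [|b t]] // _ _ min.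
by case: (min [:: a] b t).
Defined.

Section Extension.
Variable D : chains.

(** The last word of the chain is stored as a morphism, whose normal form recovers it. *)
Record extension : Type := Extension {
  ext_base : D;
  ext_vertex : vertex NF;
  ext_arr : hom (ftgt (chain_obj ext_base)) (vobj ext_vertex);
  ext_minimal : minimal_extension ext_base (nf ext_arr) }.

Definition ext_obj (c : extension) : fact_obj C :=
  FactObj (farr (chain_obj (ext_base c)) ;; ext_arr c).

Lemma extension_eq (c c' : extension) : ext_base c = ext_base c' ->
  nf (ext_arr c) = nf (ext_arr c') -> c = c'.
Proof.
case: c c' => [b v t m] [b' v' t' m'] /= bb; subst b' => tt.
have {tt} tt := nf_inj_src tt.
have vv : v = v' by apply: vertex_obj_inj; apply: (f_equal (@projT1 _ _) tt).
subst v'; have {tt} tt := inj_pairT2 _ _ _ _ _ tt; subst t'.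
by rewrite (Prop_irrelevance m m').
Qed.

Lemma ext_represents (c : extension) : represents (farr (ext_obj c))
  (chain_word (ext_base c) ++ nf (ext_arr c)).
Proof. by apply: represents_comp; [apply: represents_chain | apply: represents_nf]. Qed.

(** An extension is determined by its base and the normal form of its last word; the bases are
    finite in number, and the words are bounded in length over a finite alphabet. *)
Lemma extension_enum : exists l : seq {classic extension}, forall c, c \in l.
Proof.
have [l l_all] := chain_enum D; have [e e_all] := finite_alphabet NF.
have [N N_max] := extension_bound D.
apply: (@injective_enum _ _ (fun c : {classic extension} =>
  (ext_base c, nf (ext_arr c))) [seq (c, s) | c <- l, s <- words_upto e N]).
  by move=> c c' [bb tt]; apply: extension_eq.
move=> c; apply: allpairs_f => //; apply: mem_words_upto => //.
case: c => b v t [/= bt min]; apply: (N_max b) => //; exact: irreducible_nf.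
Qed.

Definition extension_chains : chains.
Proof.
refine (@Chains {classic extension} ext_obj
  (fun c => chain_word (ext_base c) ++ nf (ext_arr c))
  (fun c s => ~ irr (nf (ext_arr c) ++ s)) ext_represents _ _ extension_enum _).
- by move=> c; apply; rewrite cats0; apply: irreducible_nf.
- by move=> c s t cs; rewrite catA => /irreducible_prefix.
have [N N_max] := minimal_bound NF; exists N => c t it nt min.
apply: N_max it nt _ => p a q /min; exact: contrapT.
Defined.

End Extension.

Local Notation M D := (free_ns (@chain_obj D)).
Local Notation gen D w := (@generator C D (@chain_obj D) w).

(** The concatenation is left unreduced, so that rewriting can compare different generators over the
    same [w]. *)
Definition rank (D : chains) (w : fact_obj C) (b : gen D w) : position :=
  (nf (fleft (projT2 b)) ++ chain_word (projT1 b) ++ nf (fright (projT2 b)),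
   size (nf (fleft (projT2 b)))).

Arguments rank : simpl never.

Definition collapsible (D : chains) (w : fact_obj C) (b : gen D w) : Prop :=
  ~ extendable (projT1 b) (nf (fright (projT2 b))).

(** Acting by [g] renormalises the two outer factors. If both concatenations are already
    irreducible, the word is kept and the left factor grows by that of [g]; otherwise the word is
    rewritten. *)
Lemma rank_act (D : chains) (w w' : fact_obj C) (g : fact_hom w w') (b : gen D w)
    (s := nf (fleft g) ++ (rank b).1 ++ nf (fright g)) :
  rewrites (farr w') s (rank (generator_act g b)).1 \/
  rank (generator_act g b) = (s, size (nf (fleft g)) + (rank b).2).
Proof.
case: b @s => c h /=; rewrite /rank /=.
set u' := fleft g; set u := fleft h; set v := fright h; set v' := fright g.
set k := chain_word c.
pose o := farr (chain_obj c).
(* Two bracketings of the same morphism, isolating the left and the right factor, so that each can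
   be rewritten in context. *)
have wE : farr w' = idc _ ;; (u' ;; u) ;; (o ;; (v ;; v')).
  by rewrite comp_idl -(factE g) -(factE h) !comp_assoc.
have wE' : farr w' = (u' ;; u) ;; o ;; (v ;; v') ;; idc _.
  by rewrite comp_idr -(factE g) -(factE h) !comp_assoc.
have ko : represents o k by apply: represents_chain.
have vv : represents (v ;; v') (nf v ++ nf v').
  by apply: represents_comp; apply: represents_nf.
have left_step : rewrites (u' ;; u) (nf u' ++ nf u) (nf (u' ;; u)) ->
    rewrites (farr w') (nf u' ++ (nf u ++ k ++ nf v) ++ nf v')
      (nf (u' ;; u) ++ k ++ nf v ++ nf v').
  move=> uu; rewrite wE.
  have := rewrites_comp (represents_idc NF _) uu (represents_comp ko vv).
  by rewrite !cat0s !catA.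
have right_step : rewrites (v ;; v') (nf v ++ nf v') (nf (v ;; v')) ->
    rewrites (farr w') (nf (u' ;; u) ++ k ++ nf v ++ nf v')
      (nf (u' ;; u) ++ k ++ nf (v ;; v')).
  move=> vv'; rewrite wE'.
  have := rewrites_comp (represents_comp (represents_nf NF (u' ;; u)) ko) vv'
    (represents_idc NF _).
  by rewrite !cats0 !catA.
have [uu|/left_step uu] := nf_comp u' u; have [v1|/right_step v1] := nf_comp v v'.
- by right; rewrite uu v1 size_cat !catA.
- by left; rewrite uu in v1 *; rewrite !catA in v1 *.
- by left; rewrite v1.
- by left; apply: rewrites_trans uu v1.
Qed.

(** When [s] is the word of a chain, the right-hand position is the rank of that chain acted on by
    [g]. An element that is lower at a chain thus stays lower at every generator over it. *)
Lemma lower_act (D : chains) (w w' : fact_obj C) (g : fact_hom w w') (b : gen D w) s :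
  lower (farr w) (rank b) (s, 0) ->
  lower (farr w') (rank (generator_act g b))
    (nf (fleft g) ++ s ++ nf (fright g), size (nf (fleft g))).
Proof.
case=> [sb|[bs /andP[b_gt0 _]]].
  have sb' : rewrites (farr w') (nf (fleft g) ++ s ++ nf (fright g))
      (nf (fleft g) ++ (rank b).1 ++ nf (fright g)).
    rewrite -(factE g).
    by apply: rewrites_comp sb _; apply: represents_nf.
  left; have [bb'|bE] := rank_act g b; first exact: rewrites_trans sb' bb'.
  by rewrite bE.
rewrite -[s]bs; have [bb'|bE] := rank_act g b; first by left.
right; rewrite bE; split=> //=.
rewrite -[X in X < _]addn0 ltn_add2l b_gt0 /=.
by rewrite size_cat leq_add2l !size_cat -addnA leq_addr.
Qed.

(** * Matching generators over extended chains with generators over their bases *)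

Section Lead.
Variable D : chains.
Local Notation ED := (extension_chains D).

(** The generator [1.c.t] attached to the extended chain [c t]. *)
Definition lead (c : ED) : gen D (chain_obj c) :=
  existT (fun b : D => fact_hom (chain_obj b) (ext_obj c)) (ext_base c)
    (@FactHom C (chain_obj (ext_base c)) (ext_obj c) (idc _) (ext_arr c)
      (congr1 (fun f => f ;; ext_arr c) (comp_idl _))).

(* The leading term of the boundary of [b], see [boundary_gen]. *)
Definition matched (w : fact_obj C) (b : gen ED w) : gen D w :=
  generator_act (projT2 b) (lead (projT1 b)).

(** For [b] of the form [u.(c t).v], collapsibility says that [t v] is irreducible, so moving [t]
    into the right factor changes no letter. *)
Lemma rank_matched (w : fact_obj C) (b : gen ED w) :
  collapsible b -> rank (matched b) = rank b.
Proof.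
case: b => c g; rewrite /collapsible /matched /rank /= => /contrapT irr_tv.
by rewrite comp_idr nf_comp_irreducible // !catA.
Qed.

(** Here [t v] is reducible, so moving [t] into the right factor rewrites the word strictly. *)
Lemma lower_matched (w : fact_obj C) (b : gen ED w) :
  ~ collapsible b -> lower (farr w) (rank (matched b)) (rank b).
Proof.
case: b => c g; rewrite /collapsible => /contrapT red_tv; left.
rewrite /matched /rank /= comp_idr.
have [E|tv] := nf_comp (ext_arr c) (fright g).
  by case: red_tv; rewrite -E; apply: irreducible_nf.
have := rewrites_comp (represents_comp (represents_nf NF (fleft g))
  (represents_chain (ext_base c))) tv (represents_idc NF _).
by rewrite comp_idr !cats0 -!catA -(factE g) /= !comp_assoc.
Qed.

(** The right factor of [matched b] has normal form [t v], and [t] is recovered as its only prefix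
    that extends the base minimally. *)
Lemma matched_inj (w : fact_obj C) (b b' : gen ED w) :
  collapsible b -> collapsible b' -> matched b = matched b' -> b = b'.
Proof.
case: b b' => [c g] [c' g']; rewrite /collapsible /matched /=.
move=> /contrapT irr_tv /contrapT irr_tv' mm.
have bb : ext_base c = ext_base c' by apply: (f_equal (@projT1 _ _) mm).
case: c c' bb => [b v t m] [b' v' t' m'] /= bb in g g' irr_tv irr_tv' mm *.
subst b'; have {}mm := inj_pairT2 _ _ _ _ _ mm.
have /= uu := f_equal (@fleft _ _ _) mm; rewrite !comp_idr in uu.
have /= vv := f_equal (@fright _ _ _) mm.
have nn : nf t ++ nf (fright g) = nf t' ++ nf (fright g').
  by rewrite -(nf_comp_irreducible irr_tv) -(nf_comp_irreducible irr_tv') vv.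
have tt := minimal_extension_uniq m m' nn.
have {tt} tt := nf_inj_src tt.
have ww : v = v' by apply: vertex_obj_inj; apply: (f_equal (@projT1 _ _) tt).
subst v'; have {tt} tt := inj_pairT2 _ _ _ _ _ tt; subst t'.
have mm' := Prop_irrelevance m m'; subst m'.
congr existT; apply: fact_hom_eq => //; apply: nf_inj.
by have := congr1 (drop (size (nf t))) nn; rewrite !drop_size_cat.
Qed.

Lemma rank_lead (c : ED) : rank (lead c) = (chain_word c, 0).
Proof. by rewrite /rank /= nf_idc. Qed.

(** The right factor is cut after its shortest extending prefix; the result is collapsible because
    the two pieces still concatenate to a normal form. *)
Lemma matched_surj (w : fact_obj C) (b : gen D w) : ~ collapsible b ->
  exists b', matched b' = b /\ collapsible b'.
Proof.
case: b => c g; rewrite /collapsible /= => /contrapT cg.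
have [s [s' [gss cs]]] := minimal_extension_exists cg.
have [y [t [v [tE vE tv]]]] := nf_split gss.
have [x xy] := vertex_obj_surj NF y; subst y; rewrite -tE in cs.
have gE : fleft g ;; farr (ext_obj (Extension cs)) ;; v = farr w.
  by rewrite /= -(factE g) -tv !comp_assoc.
exists (existT (fun c' : ED => fact_hom (chain_obj c') w)
  (Extension cs : ED) (@FactHom C (ext_obj (Extension cs)) w (fleft g) v gE)).
split.
  by congr existT; apply: fact_hom_eq; rewrite /= ?comp_idr.
apply; rewrite /= vE tE -gss; exact: irreducible_nf.
Qed.
End Lead.

(** The invariant of the recursion on the degree: the first half makes collapsible cycles vanish,
    the second supplies the lower elements that define the next boundary. *)
Definition good (D : chains) (T : natsys C) (d : nat_trans (M D) T) : Prop :=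
  (forall w (y : nsval (M D) w),
     spanned (@collapsible D w) y -> nsmap d w y = 0%R -> y = 0%R) /\
  (forall c : extension_chains D, exists z : nsval (M D) (chain_obj c),
     spanned (fun b => lower (farr (chain_obj c)) (rank b) (chain_word c, 0)) z /\
     nsmap d _ z = nsmap d _ (fns_gen (lead c))).

(** * One step of the resolution *)

Section Step.
Variables (D : chains) (T : natsys C) (d : nat_trans (M D) T).
Hypothesis d_good : good d.
Local Notation ED := (extension_chains D).

Definition correction (c : ED) : nsval (M D) (chain_obj c) :=
  sval (cid (d_good.2 c)).

Lemma correction_lower (c : ED) :
  spanned (fun b => lower (farr (chain_obj c)) (rank b) (chain_word c, 0))
    (correction c).
Proof. exact: (svalP (cid (d_good.2 c))).1. Qed.

Lemma correctionE (c : ED) :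
  nsmap d _ (correction c) = nsmap d _ (fns_gen (lead c)).
Proof. exact: (svalP (cid (d_good.2 c))).2. Qed.

Definition boundary : nat_trans (M ED) (M D) :=
  @free_ns_lift C ED (@chain_obj ED) (M D)
    (fun c : ED => (fns_gen (lead c) - correction c)%R).

(** Triangularity. The remainder is bounded by the rank of [b], which is also that of the leading
    term when [b] is collapsible. *)
Lemma boundary_gen (w : fact_obj C) (b : gen ED w) :
  exists z : nsval (M D) w, 
    spanned (fun b' => lower (farr w) (rank b') (rank b)) z /\
    nsmap boundary w (fns_gen b) = (fns_gen (matched b) - z)%R.
Proof.
exists (nsact (M D) (projT2 b) (correction (projT1 b))); split.
  apply: (spanned_act _ (@correction_lower (projT1 b))) => b'; exact: lower_act.
by rewrite free_ns_liftU raddfB free_ns_actU.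
Qed.

Lemma boundary_boundary (w : fact_obj C) y : nsmap d w (nsmap boundary w y) = 0%R.
Proof.
move: y; apply: free_ns_ind => [|y1 y2 E1 E2|b]; first by rewrite !raddf0.
  by rewrite !raddfB E1 E2 subr0.
by rewrite free_ns_liftU nsmap_nat raddfB correctionE subrr raddf0.
Qed.

Section DownClosed.
Variables (w : fact_obj C) (P : position -> Prop).
Hypothesis P_down : forall p q, lower (farr w) q p -> P p -> P q.

(** The down-closed set [P] lets one reduction serve two ends: exactness, with [P] everything, and
    the next correction, with [P] the positions below a chain. *)
Lemma reduction_gen (b : gen D w) : P (rank b) ->
  exists z : nsval (M ED) w, spanned (fun b' => P (rank b')) z /\
    spanned (@collapsible D w) (fns_gen b - nsmap boundary w z)%R.
Proof.
move E : (rank b) => p; elim: (lower_wf (farr w) p) b E => {}p _ IH b bp Pp.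
have [cb|/matched_surj[b' [bE cb']]] := pselect (collapsible b).
  exists 0%R; split; first exact: spanned0.
  by rewrite raddf0 subr0; apply: spanned_gen.
(* Equality of ranks puts the remainder of the boundary of [b'] below [b], where the induction
   hypothesis applies. *)
have rb : rank b' = p by rewrite -rank_matched // bE.
have [z [z_low zE]] := boundary_gen b'; rewrite rb bE in z_low zE.
have [z' [z'P z'E]] : exists z' : nsval (M ED) w, spanned (fun b' => P (rank b')) z' /\
    spanned (@collapsible D w) (z - nsmap boundary w z')%R.
  move: z z_low {zE}; apply: spanned_ind.
  - by exists 0%R; rewrite raddf0 subr0; split; apply: spanned0.
  - move=> y1 y2 [z1 [P1 E1]] [z2 [P2 E2]]; exists (z1 - z2)%R.
    by rewrite raddfB opprD addrACA -opprD; split; apply: spannedB.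
  - by move=> b1 b1p; apply: (IH _ b1p b1 erefl); apply: P_down b1p Pp.
(* The boundary of [b'] is [b - z], so what is left of [b] is [z] minus the boundary of [z']. *)
exists (fns_gen b' + z')%R; split.
  by apply: spannedD => //; apply: spanned_gen; rewrite rb.
by rewrite raddfD zE opprD opprB addrA [X in (X - _)%R]addrC subrK.
Qed.

Lemma reduction (y : nsval (M D) w) : spanned (fun b => P (rank b)) y ->
  exists z : nsval (M ED) w, spanned (fun b => P (rank b)) z /\
    spanned (@collapsible D w) (y - nsmap boundary w z)%R.
Proof.
move: y; apply: spanned_ind => [|y1 y2 [z1 [P1 E1]] [z2 [P2 E2]]|].
- by exists 0%R; rewrite raddf0 subr0; split; apply: spanned0.
- exists (z1 - z2)%R.
  by rewrite raddfB opprD addrACA -opprD; split; apply: spannedB.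
- exact: reduction_gen.
Qed.

(** The collapsible rest left by [reduction] is again a cycle, hence zero. *)
Lemma cycle_lift (y : nsval (M D) w) : spanned (fun b => P (rank b)) y ->
  nsmap d w y = 0%R ->
  exists z : nsval (M ED) w, spanned (fun b => P (rank b)) z /\
    nsmap boundary w z = y.
Proof.
move=> /reduction[z [zP yz]] dy; exists z; split=> //; symmetry.
apply/eqP; rewrite -subr_eq0; apply/eqP; apply: d_good.1 yz _.
by rewrite raddfB dy boundary_boundary subr0.
Qed.

End DownClosed.

Lemma boundary_exact : ns_exact boundary d.
Proof.
move=> w y; split=> [dy|[z <-]]; last exact: boundary_boundary.
by have [//|//|z [_ zE]] := @cycle_lift w (fun=> True) _ y _ dy; exists z.
Qed.

(* The coefficient of [y] at a maximal generator [k0] is that of its boundary at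
   [matched k0]. *)
Lemma boundary_collapsible (w : fact_obj C) (y : nsval (M ED) w) :
  spanned (@collapsible ED w) y -> nsmap boundary w y = 0%R -> y = 0%R.
Proof.
move=> y_col dy; apply/eqP; rewrite -dom_eq0; apply: contrapT => /negP/eqP y0.
have [k0 k0y k0_max] := exists_maximal y0
  (fun k k' k'' => @lower_trans _ _ (farr w) (rank k'') (rank k') (rank k)) 
  (fun k => @lower_irreflexive _ _ (farr w) (rank k)).
have k0_col : collapsible k0 by apply: y_col; rewrite -mem_dom.
pose P (k : gen ED w) := collapsible k /\ ~ lower (farr w) (rank k0) (rank k).
have coefE : forall y, spanned P y ->
    coeff (matched k0 : {classic gen D w}) (nsmap boundary w y) =
    coeff (k0 : {classic gen ED w}) y.
  apply: spanned_ind => [|y1 y2 E1 E2|k [k_col k0k]].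
  - by rewrite raddf0 !coeff0.
  - by rewrite raddfB !coeffB E1 E2.
  have [z [z_low ->]] := boundary_gen k.
  rewrite coeffB [X in (_ - X)%R](_ : _ = 0%R).
    rewrite subr0 !coeffU !mul1r; congr (nat_of_bool _)%:R%R.
    apply/eqP/eqP => [|-> //]; exact: matched_inj.
  (* If [matched k0] occurred in the remainder, its rank, which is that of [k0], would be lower than
     the rank of [k], against the maximality of [k0]. *)
  apply/eqP; apply: contrapT => /negP/z_low.
  by rewrite rank_matched.
have : coeff (k0 : {classic gen ED w}) y = 0%R.
  rewrite -coefE ?dy ?coeff0 // => k ky.
  by split; [apply: y_col | apply: k0_max; rewrite mem_dom].
by move: k0y; rewrite mem_dom => /eqP.
Qed.

(** For the second half, the boundary of [lead c] is a cycle supported strictly below [c]; lifting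
    it without going up gives the required element. *)
Lemma boundary_good : good boundary.
Proof.
split=> [w y|c]; first exact: boundary_collapsible.
pose P p := lower (farr (chain_obj c)) p (chain_word c, 0).
have [z0 [z0_low dE]] := boundary_gen (lead c).
have ncol : ~ collapsible (lead c) by apply; apply: (ext_minimal c).1.
have [|||z [zP zE]] := @cycle_lift (chain_obj c) P _ (nsmap boundary _ (fns_gen (lead c))).
- by move=> p q qp pP; apply: lower_trans qp pP.
(* Both parts of the boundary lie below [c]: the remainder by triangularity, the leading term
   because [lead c] is not collapsible. *)
- rewrite dE; apply: spannedB; last by apply: spanned_sub z0_low => b; rewrite rank_lead.
  by apply: spanned_gen; rewrite /P -rank_lead; apply: lower_matched.
- exact: boundary_boundary.
by exists z.
Qed.

End Step.

(** * The augmentation as the base case *)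

Definition augmentation : nat_trans (M vertex_chains) (constant_natsys C int) :=
  @free_ns_lift C vertex_chains (@chain_obj vertex_chains)
    (constant_natsys C int) (fun=> 1%R).

Lemma augmentation_gen (w : fact_obj C) (b : gen vertex_chains w) :
  nsmap augmentation w (fns_gen b) = 1%R.
Proof. by rewrite free_ns_liftU. Qed.

Lemma augmentation_surjective : ns_surjective augmentation.
Proof.
move=> [x y f] m; have [v vy] := vertex_obj_surj NF y; subst y.
have fE : f ;; idc (vobj v) ;; idc (vobj v) = f by rewrite !comp_idr.
pose b : gen vertex_chains (FactObj f) :=
  existT (fun b : vertex NF => fact_hom (FactObj (idc (vobj b))) (FactObj f)) v
    (@FactHom C (FactObj (idc (vobj v))) (FactObj f) _ _ fE).
by exists (fns_gen b *~ m)%R; rewrite raddfMz augmentation_gen intz.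
Qed.

(** Over a vertex, collapsible means that the right factor is an identity, which leaves the
    generator [f.1.1] as the only one over a morphism [f]. *)
Lemma collapsible_vertex (w : fact_obj C) (b b' : gen vertex_chains w) :
  collapsible b -> collapsible b' -> b = b'.
Proof.
case: b b' => [v g] [v' g'] /contrapT /= g0 /contrapT /= g0'.
have gv := nf_eq_nil g0; have gv' := nf_eq_nil g0'.
have vv : v = v'.
  apply: vertex_obj_inj.
  exact: etrans (esym (f_equal (@projT1 _ _) gv)) (f_equal (@projT1 _ _) gv').
subst v'; congr existT; apply: fact_hom_eq; last by apply: nf_inj; rewrite g0.
have := factE g; have := factE g'; have := f_equal (@projT1 _ _) gv.
move: w g g' gv gv' {g0 g0'} => [x y f] /= [u r e] [u' r' e'] /= gv gv' yv.
subst y; rewrite (inj_pairT2 _ _ _ _ _ gv) (inj_pairT2 _ _ _ _ _ gv').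
by rewrite !comp_idr => -> ->.
Qed.

Lemma augmentation_good : good augmentation.
Proof.
split=> [w y y_col dy|c].
  apply/eqP; rewrite -dom_eq0; apply: contrapT => /negP/eqP y0.
  have [b by_] : exists b, b \in dom y.
    by case: (dom y) y0 => // b s _; exists b; rewrite mem_head.
  rewrite mem_dom in by_.
  (* By [collapsible_vertex], [b] is the only generator in the support of [y]. *)
  have yE : y = (fns_gen b *~ coeff b y)%R.
    rewrite /fns_gen freegU_mulz intz; apply/eqP/freeg_eqP => b'.
    rewrite coeffU; have [->|bb'] := eqVneq b b'; first by rewrite mulr1.
    rewrite mulr0; apply/eqP; apply: contrapT => /negP/y_col b'_col.
    by case/eqP: bb'; apply: collapsible_vertex b'_col; apply: y_col.
  move: dy; rewrite yE raddfMz augmentation_gen intz => b0.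
  by rewrite b0 eqxx in by_.
pose v := ext_vertex c.
have gE : farr (chain_obj c) ;; idc (vobj v) ;; idc (vobj v) = farr (chain_obj c).
  by rewrite !comp_idr.
(* For a letter [t], the lower element is [t.1.1]: it has the same word as [1.1.t], but all of it
   stands in the left factor. *)
pose b : gen vertex_chains (chain_obj c) :=
  existT (fun b : vertex NF => fact_hom (FactObj (idc (vobj b))) (ext_obj c)) v
    (@FactHom C (FactObj (idc (vobj v))) (ext_obj c) _ _ gE).
exists (fns_gen b); split; last by rewrite !augmentation_gen.
apply: spanned_gen; right; rewrite /rank /= nf_idc comp_idl cats0; split=> //.
rewrite leqnn andbT; case: (nf (ext_arr c)) (ext_minimal c).1 => //.
Qed.

(** * Assembly of the resolution *)

Fixpoint chains_of_length (n : nat) : chains :=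
  if n is m.+1 then extension_chains (chains_of_length m) else vertex_chains.

(** The target [T] is part of the data because it changes with the degree: first the constant
    system, afterwards the free system on the previous chains. *)
Definition stage (D : chains) : Type :=
  {T : natsys C & {d : nat_trans (M D) T | good d}}.

Definition stage_boundary (D : chains) (s : stage D) :
    nat_trans (M (extension_chains D)) (M D) := boundary (svalP (projT2 s)).

Definition next_stage (D : chains) (s : stage D) : stage (extension_chains D) :=
  existT _ (M D) (exist _ (stage_boundary s) (boundary_good (svalP (projT2 s)))).

Fixpoint resolution_stage (n : nat) : stage (chains_of_length n) :=
  if n is m.+1 then next_stage (resolution_stage m)
  else existT _ _ (exist _ augmentation augmentation_good).

Lemma stage_exact (D : chains) (s : stage D) :
  ns_exact (stage_boundary s) (sval (projT2 s)).
Proof. exact: boundary_exact. Qed.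

Lemma FP_infty_of_normal_forms : FP_infty C.
Proof.
exists (fun n => M (chains_of_length n)), (fun n => stage_boundary (resolution_stage n)),
  augmentation; split.
- move=> n; have [l l_all] := chain_enum (chains_of_length n).
  by split; [apply: free_ns_fin_generated l_all | apply: free_ns_projective].
- exact: augmentation_surjective.
- exact: (stage_exact (resolution_stage 0)).
- by move=> n; apply: (stage_exact (resolution_stage n.+1)).
Qed.
End Resolution.

Theorem corollary5p4p5 (C : category)
    (hC : exists S : polygraph,
        [/\ finite_polygraph S, convergent S & presentation S C]) :
  FP_infty C.
Proof.
have [S [S_finite [S_terminating S_confluent] [F [G [FG GF]]]]] := hC.
exact: FP_infty_of_normal_forms
  (normal_forms_of_presentation S_terminating S_confluent FG GF S_finite).
Qed.
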